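(* Each of the following sets is $\Sigma^0_1$-complete: (a) the set of finite TRSs $R$ that are weakly confluent (weakly confluent on every term, including open terms); (b) the set of pairs $(R,t)$, $R$ a finite TRS and $t$ a term, such that $R$ is weakly confluent on $t$; (c) the set of pairs $(R,t)$, $R$ a finite TRS and $t$ a ground term, such that $R$ is weakly confluent on $t$.
   Context: All TRSs are finite sets of rules over a finite signature; terms may contain variables, ground terms contain none. A TRS $R$ is weakly confluent on a term $t$ if for all terms $t_1,t_2$ with $t_1\leftarrow_R t\to_R t_2$ (single steps) there is a term $d$ with $t_1\to_R^* d\leftarrow_R^* t_2$. TRSs and terms are encoded as natural numbers by a standard effective Gödel numbering, and properties are identified with the corresponding sets of codes. $\Sigma^0_n,\Pi^0_n$ are the classes of the arithmetical hierarchy; a set $B$ is $\mathcal P$-complete if $B\in\mathcal P$ and every $A\in\mathcal P$ is many-one reducible to $B$ via a total computable function. *)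

(* Defs.v *)
From Stdlib Require Import Arith List Relations.
Import ListNotations.

(* Function symbols are natural numbers; a symbol is identified by its
   name together with the number of its arguments (so f(x) and f(x,y)
   use distinct symbols (f,1),(f,2)).  Any finite TRS/term uses only
   finitely many symbols. *)
Inductive term : Type :=
| Var : nat -> term
| Fun : nat -> list term -> term.

Fixpoint subst (s : nat -> term) (t : term) : term :=
  match t with
  | Var x => s x
  | Fun f ts => Fun f (map (subst s) ts)
  end.

Fixpoint vars (t : term) : list nat :=
  match t with
  | Var x => [x]
  | Fun _ ts => flat_map vars ts
  end.

Definition ground (t : term) : Prop := vars t = [].

Definition rule : Type := (term * term)%type.
Definition trs : Type := list rule.

Definition wf_rule (r : rule) : Prop :=
  (forall x, fst r <> Var x) /\
  (forall x, In x (vars (snd r)) -> In x (vars (fst r))).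

Definition wf_trs (R : trs) : Prop := forall r, In r R -> wf_rule r.

Inductive step (R : trs) : term -> term -> Prop :=
| step_root : forall l r (s : nat -> term),
    In (l, r) R -> step R (subst s l) (subst s r)
| step_ctx : forall f pre post a b,
    step R a b -> step R (Fun f (pre ++ a :: post)) (Fun f (pre ++ b :: post)).

Definition steps (R : trs) : term -> term -> Prop := clos_refl_trans term (step R).

Definition weakly_confluent_on (R : trs) (t : term) : Prop :=
  forall t1 t2, step R t t1 -> step R t t2 ->
    exists d, steps R t1 d /\ steps R t2 d.

Definition weakly_confluent (R : trs) : Prop :=
  forall t, weakly_confluent_on R t.

(* Goedel numbering (decoding direction; every number codes an object) *)

(* Cantor unpairing, enumerating N x N diagonal by diagonal *)
Fixpoint unpair (n : nat) : nat * nat :=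
  match n with
  | 0 => (0, 0)
  | S n' => let (x, y) := unpair n' in
            match x with
            | 0 => (S y, 0)
            | S x' => (x', S y)
            end
  end.

(* code of a term:  2x        = Var x
                    2<f,l>+1  = Fun f (list coded by l)
   code of a list:  0 = [], <h,t>+1 = h :: t.
   The fuel argument is sufficient when fuel = code + 1. *)
Fixpoint dterm (fuel n : nat) : term :=
  match fuel with
  | 0 => Var 0
  | S fu =>
      if Nat.even n then Var (Nat.div2 n)
      else let (f, l) := unpair (Nat.div2 n) in Fun f (dterms fu l)
  end
with dterms (fuel l : nat) : list term :=
  match fuel with
  | 0 => []
  | S fu =>
      match l with
      | 0 => []
      | S k => let (h, t) := unpair k in dterm fu h :: dterms fu t
      end
  end.

Definition decode_term (n : nat) : term := dterm (S n) n.

Fixpoint dseq (fuel l : nat) : list nat :=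
  match fuel with
  | 0 => []
  | S fu =>
      match l with
      | 0 => []
      | S k => let (h, t) := unpair k in h :: dseq fu t
      end
  end.

Definition decode_seq (n : nat) : list nat := dseq (S n) n.

Definition decode_rule (n : nat) : rule :=
  let (a, b) := unpair n in (decode_term a, decode_term b).

Definition decode_trs (n : nat) : trs := map decode_rule (decode_seq n).

Inductive recfun : Type :=
| RZero : recfun
| RSucc : recfun
| RProj : nat -> recfun
| RComp : recfun -> list recfun -> recfun
| RPrec : recfun -> recfun -> recfun
| RMu   : recfun -> recfun.

Inductive eval : recfun -> list nat -> nat -> Prop :=
| ev_zero : forall a, eval RZero a 0
| ev_succ : forall a, eval RSucc a (S (hd 0 a))
| ev_proj : forall i a, eval (RProj i) a (nth i a 0)
| ev_comp : forall f gs a ys y,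
    eval_list gs a ys -> eval f ys y -> eval (RComp f gs) a y
| ev_prec0 : forall f g a y,
    eval f a y -> eval (RPrec f g) (0 :: a) y
| ev_precS : forall f g n a z y,
    eval (RPrec f g) (n :: a) z -> eval g (n :: z :: a) y ->
    eval (RPrec f g) (S n :: a) y
| ev_mu : forall f a y,
    eval f (y :: a) 0 ->
    (forall z, z < y -> exists v, v <> 0 /\ eval f (z :: a) v) ->
    eval (RMu f) a y
with eval_list : list recfun -> list nat -> list nat -> Prop :=
| evl_nil : forall a, eval_list [] a []
| evl_cons : forall g gs a y ys,
    eval g a y -> eval_list gs a ys -> eval_list (g :: gs) a (y :: ys).

Definition computable (f : nat -> nat) : Prop :=
  exists p, forall n, eval p [n] (f n).

Definition recursive2 (Q : nat -> nat -> Prop) : Prop :=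
  exists p, forall n m,
    (Q n m -> eval p [n; m] 1) /\ (~ Q n m -> eval p [n; m] 0).

Definition Sigma01 (A : nat -> Prop) : Prop :=
  exists Q, recursive2 Q /\ forall n, A n <-> exists m, Q n m.

Definition many_one_reducible (A B : nat -> Prop) : Prop :=
  exists f, computable f /\ forall n, A n <-> B (f n).

Definition Sigma01_complete (B : nat -> Prop) : Prop :=
  Sigma01 B /\ forall A, Sigma01 A -> many_one_reducible A B.

Definition WCR_set (n : nat) : Prop :=
  wf_trs (decode_trs n) /\ weakly_confluent (decode_trs n).

Definition WCR_term_set (n : nat) : Prop :=
  let (a, b) := unpair n in
  wf_trs (decode_trs a) /\ weakly_confluent_on (decode_trs a) (decode_term b).

Definition WCR_ground_set (n : nat) : Prop :=
  let (a, b) := unpair n in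
  wf_trs (decode_trs a) /\ ground (decode_term b) /\
  weakly_confluent_on (decode_trs a) (decode_term b).

(* Main.v *)
(* Membership: weak confluence on t asks for common reducts of the finitely many
   pairs of one-step reducts of t, and weak confluence on all terms asks for common
   reducts of the finitely many critical pairs, computed by unification; both are
   searches for a number bounding the lengths of all rewrite sequences involved.

   Hardness: recursive functions are evaluated by a fixed non-overlapping TRS in
   continuation-passing style, in which every reachable configuration has at most
   one redex, at the root. Adding a constant start with two rules, one to the search for a
   witness of n and one to a normal form accept, creates a single nontrivial critical pair,
   which is joinable, on start as well as on all terms, exactly if the search
   succeeds. *)
From Stdlib Require Import Arith List Relations Lia Bool Classical.
Require Import Defs.
Import ListNotations.

(** * Computable functions on numbers *)

(** [Sigma01] and [many_one_reducible] refer to [recfun], so every check and the reduction must be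
    traced down to recursive functions on codes. The instances of [Enc] invert the decoders; above a
    few explicit programs for arithmetic and pairing, functions on terms and systems are then
    handled by closure properties of [Comp]. Unification is a single transition that is iterated:
    the number bounding the rewrite sequences also bounds the iterations, and termination is proved
    only to see that a large enough bound exists. The critical pair criterion speaks of all
    unifiers, which agrees with testing a solved form because joinability is closed under
    substitution. For hardness it is never shown that a rewrite sequence comes from an evaluation.
    If there is no witness, every test still returns a value, a nonzero one, because the relation is
    decided by a total program. The search then passes through infinitely many loop states, and
    determinism forbids it to reach the normal form [tAccept]. *)

Fixpoint tri (n : nat) : nat :=
  match n with 0 => 0 | S k => S k + tri k end.

Definition cpair (x y : nat) : nat := tri (x + y) + y.
Definition cfst (n : nat) : nat := fst (unpair n).
Definition csnd (n : nat) : nat := snd (unpair n).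

(** [unpair] enters diagonal s at the number [tri s] with the pair (s, 0) and walks down it; the
    induction is on the diagonal and, inside it, on the position. *)
Lemma unpair_cpair x y : unpair (cpair x y) = (x, y).
Proof.
  assert (H : forall s y, y <= s -> unpair (tri s + y) = (s - y, y)).
  { induction s as [|s IHs].
    - intros [|z] Hz; [reflexivity|lia].
    - intros z. induction z as [|z IHz]; intros Hz.
      + replace (tri (S s) + 0) with (S (tri s + s)) by (simpl; lia).
        simpl. rewrite IHs, Nat.sub_diag by lia. f_equal.
      + rewrite Nat.add_succ_r.
        cbn [unpair]. rewrite IHz by lia.
        replace (S s - z) with (S (s - z)) by lia. reflexivity. }
  unfold cpair. rewrite H by lia. f_equal. lia.
Qed.

Lemma cfst_cpair x y : cfst (cpair x y) = x.
Proof. unfold cfst. now rewrite unpair_cpair. Qed.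

Lemma csnd_cpair x y : csnd (cpair x y) = y.
Proof. unfold csnd. now rewrite unpair_cpair. Qed.

Lemma cpair_unpair n : cpair (cfst n) (csnd n) = n.
Proof.
  unfold cfst, csnd, cpair. induction n as [|n IH]; [reflexivity|].
  cbn [unpair]. destruct (unpair n) as [[|x] y]; cbn [fst snd] in *.
  - rewrite !Nat.add_0_r. simpl in *. lia.
  - rewrite !Nat.add_succ_r. simpl in *. lia.
Qed.

Lemma le_tri n : n <= tri n.
Proof. induction n; simpl; lia. Qed.

Lemma le_cpair x y : x <= cpair x y /\ y <= cpair x y.
Proof. unfold cpair. pose proof (le_tri (x + y)). lia. Qed.

Lemma eval_comp1 f g a x y :
  eval g a x -> eval f [x] y -> eval (RComp f [g]) a y.
Proof. intros. eapply ev_comp; [|eassumption]. repeat constructor; assumption. Qed.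

Lemma eval_comp2 f g h a x y z :
  eval g a x -> eval h a y -> eval f [x; y] z -> eval (RComp f [g; h]) a z.
Proof. intros. eapply ev_comp; [|eassumption]. repeat constructor; assumption. Qed.

Lemma eval_proj i a x : nth i a 0 = x -> eval (RProj i) a x.
Proof. intros <-. constructor. Qed.

Lemma eval_succ x a : eval RSucc (x :: a) (S x).
Proof. exact (ev_succ (x :: a)). Qed.

Definition rAdd := RPrec (RProj 0) (RComp RSucc [RProj 1]).
Definition rPred := RPrec RZero (RProj 0).
(** Recursion runs on the head of the argument list, so the subtrahend comes first. *)
Definition rSub := RPrec (RProj 0) (RComp rPred [RProj 1]).
Definition rTri := RPrec RZero (RComp rAdd [RComp RSucc [RProj 0]; RProj 1]).
Definition rPair := RComp rAdd [RComp rTri [rAdd]; RProj 1].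

Lemma eval_rAdd n x : eval rAdd [n; x] (n + x).
Proof.
  induction n as [|n IH].
  - apply ev_prec0, eval_proj. reflexivity.
  - eapply ev_precS; [exact IH|].
    eapply eval_comp1; [apply eval_proj; reflexivity|apply eval_succ].
Qed.

Lemma eval_rPred n : eval rPred [n] (pred n).
Proof.
  induction n as [|n IH].
  - apply ev_prec0. constructor.
  - eapply ev_precS; [exact IH|]. apply eval_proj. reflexivity.
Qed.

Lemma eval_rSub n x : eval rSub [n; x] (x - n).
Proof.
  induction n as [|n IH].
  - apply ev_prec0, eval_proj. simpl. lia.
  - eapply ev_precS; [exact IH|].
    eapply eval_comp1; [apply eval_proj; reflexivity|].
    replace (x - S n) with (pred (x - n)) by lia. apply eval_rPred.
Qed.

Lemma eval_rTri n : eval rTri [n] (tri n).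
Proof.
  induction n as [|n IH].
  - apply ev_prec0. constructor.
  - eapply ev_precS; [exact IH|].
    eapply eval_comp2; [|apply eval_proj; reflexivity|apply eval_rAdd].
    eapply eval_comp1; [apply eval_proj; reflexivity|apply eval_succ].
Qed.

Lemma eval_rPair x y : eval rPair [x; y] (cpair x y).
Proof.
  eapply eval_comp2; [|apply eval_proj; reflexivity|apply eval_rAdd].
  eapply eval_comp1; [apply eval_rAdd|apply eval_rTri].
Qed.

(* The index of the Cantor diagonal through n moves to the next diagonal
   exactly when n + 1 is the triangular number starting it. *)
Definition rDiag := RPrec RZero
  (RComp rAdd
    [RComp rSub
       [RComp rSub [RComp RSucc [RProj 0];
                    RComp rTri [RComp RSucc [RProj 1]]];
        RComp RSucc [RZero]];
     RProj 1]).

(** If d is the diagonal of n, then n = tri d + y with x + y = d; hence y = n - tri d and x = d -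
    y. *)
Definition rSnd := RComp rSub [RComp rTri [rDiag]; RProj 0].
Definition rFst := RComp rSub [rSnd; rDiag].

Lemma eval_rDiag n : eval rDiag [n] (cfst n + csnd n).
Proof.
  induction n as [|n IH].
  - apply ev_prec0. constructor.
  (* The inner difference equals [cfst n], so the truncated subtraction from 1 gives 1 exactly at
     the last entry of a diagonal. *)
  - assert (E : cfst (S n) + csnd (S n) =
                1 - (tri (S (cfst n + csnd n)) - S n) + (cfst n + csnd n)).
    { pose proof (cpair_unpair n) as P. unfold cpair, cfst, csnd in *.
      clear IH. cbn [unpair]. destruct (unpair n) as [[|x] y]; cbn [fst snd tri plus] in *; lia. }
    rewrite E. eapply ev_precS; [exact IH|].
    eapply eval_comp2; [|apply eval_proj; reflexivity|apply eval_rAdd].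
    eapply eval_comp2; [| |apply eval_rSub].
    + eapply eval_comp2; [| |apply eval_rSub].
      * eapply eval_comp1; [apply eval_proj; reflexivity|apply eval_succ].
      * eapply eval_comp1; [|apply eval_rTri].
        eapply eval_comp1; [apply eval_proj; reflexivity|apply eval_succ].
    + eapply eval_comp1; [apply ev_zero|apply eval_succ].
Qed.

Lemma eval_rSnd n : eval rSnd [n] (csnd n).
Proof.
  replace (csnd n) with (n - tri (cfst n + csnd n))
    by (pose proof (cpair_unpair n) as P; unfold cpair in P; lia).
  eapply eval_comp2; [|apply eval_proj; reflexivity|apply eval_rSub].
  eapply eval_comp1; [apply eval_rDiag|apply eval_rTri].
Qed.

Lemma eval_rFst n : eval rFst [n] (cfst n).
Proof.
  replace (cfst n) with ((cfst n + csnd n) - csnd n) by lia.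
  eapply eval_comp2; [apply eval_rSnd|apply eval_rDiag|apply eval_rSub].
Qed.

Lemma computable_ext f g : (forall n, f n = g n) -> computable f -> computable g.
Proof. intros E [p H]. exists p. intro n. rewrite <- E. apply H. Qed.

Lemma computable_comp f g :
  computable f -> computable g -> computable (fun n => f (g n)).
Proof. intros [p H] [q I]. exists (RComp p [q]). intro n. eapply eval_comp1; eauto. Qed.

Lemma computable_id : computable (fun n => n).
Proof. exists (RProj 0). intro n. now apply eval_proj. Qed.

Lemma computable_const c : computable (fun _ => c).
Proof.
  induction c as [|c [p H]].
  - exists RZero. constructor.
  - exists (RComp RSucc [p]). intro n. eapply eval_comp1; [apply H|apply eval_succ].
Qed.

Lemma computable_S : computable S.
Proof. exists RSucc. intro n. apply eval_succ. Qed.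

Lemma computable_cfst : computable cfst.
Proof. exists rFst. apply eval_rFst. Qed.

Lemma computable_csnd : computable csnd.
Proof. exists rSnd. apply eval_rSnd. Qed.

Lemma computable_cpair f g :
  computable f -> computable g -> computable (fun n => cpair (f n) (g n)).
Proof.
  intros [p H] [q I]. exists (RComp rPair [p; q]). intro n.
  eapply eval_comp2; [apply H|apply I|apply eval_rPair].
Qed.

Definition natrec {B : Type} (b : B) (g : nat -> B -> B) (n : nat) : B :=
  nat_rect (fun _ => B) b g n.

Lemma natrec_S {B} (b : B) g n : natrec b g (S n) = g n (natrec b g n).
Proof. reflexivity. Qed.

Lemma computable_natrec f g h :
  computable f -> computable g -> computable h ->
  computable (fun a => natrec (f a) (fun k z => g (cpair a (cpair k z))) (h a)).
Proof.
  intros [p P] [q Q] [r R].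
  (* The step program receives the counter, the previous value and the parameter in this order; they
     are packed with the parameter in front. *)
  exists (RComp (RPrec p (RComp q [RComp rPair [RProj 2; RComp rPair [RProj 0; RProj 1]]]))
                [r; RProj 0]).
  intro a. eapply eval_comp2; [apply R|apply eval_proj; reflexivity|].
  induction (h a) as [|n IH].
  - apply ev_prec0, P.
  - eapply ev_precS; [exact IH|]. eapply eval_comp1; [|apply Q].
    eapply eval_comp2; [apply eval_proj; reflexivity| |apply eval_rPair].
    eapply eval_comp2; [apply eval_proj; reflexivity|apply eval_proj; reflexivity|
      apply eval_rPair].
Qed.

(** Case distinction is primitive recursion whose step forgets the previous value; [g'] does the
    forgetting. *)
Lemma computable_case f g h :
  computable f -> computable g -> computable h ->
  computable (fun a => match h a with 0 => f a | S m => g (cpair a m) end).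
Proof.
  intros F G H.
  pose (g' := fun z => g (cpair (cfst z) (cfst (csnd z)))).
  assert (G' : computable g').
  { apply (computable_comp g); [exact G|].
    apply computable_cpair; [apply computable_cfst|].
    apply (computable_comp cfst csnd); [apply computable_cfst|apply computable_csnd]. }
  eapply computable_ext; [|exact (computable_natrec f g' h F G' H)].
  intro a. cbn beta. destruct (h a) as [|m]; [reflexivity|]. simpl. unfold g'.
  now rewrite csnd_cpair, !cfst_cpair.
Qed.

(** * Computable functions on encoded data *)

Class Enc (A : Type) := enc : A -> nat.

#[global] Instance Enc_nat : Enc nat := fun n => n.
#[global] Instance Enc_bool : Enc bool := fun b => if b then 1 else 0.
#[global] Instance Enc_prod {A B} `{Enc A} `{Enc B} : Enc (A * B) :=
  fun p => cpair (enc (fst p)) (enc (snd p)).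
#[global] Instance Enc_list {A} `{Enc A} : Enc (list A) :=
  fold_right (fun a m => S (cpair (enc a) m)) 0.

(** Inverse of [dterm]. The fold over the arguments is written out for the sake of the nested
    recursion; it is convertible to the list instance of [Enc]. *)
Fixpoint term_code (t : term) : nat :=
  match t with
  | Var x => 2 * x
  | Fun f ts =>
      S (2 * cpair f (fold_right (fun t m => S (cpair (term_code t) m)) 0 ts))
  end.

#[global] Instance Enc_term : Enc term := term_code.

(** The tracking function is constrained on codes only, so a function may be replaced by any
    pointwise equal one on the type itself. *)
Definition Comp {A B} `{Enc A} `{Enc B} (f : A -> B) : Prop :=
  exists h, computable h /\ forall a, h (enc a) = enc (f a).
Definition Comp2 {A B C} `{Enc A} `{Enc B} `{Enc C} (f : A -> B -> C) : Prop :=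
  Comp (fun p => f (fst p) (snd p)).
Definition Comp3 {A B C D} `{Enc A} `{Enc B} `{Enc C} `{Enc D}
  (f : A -> B -> C -> D) : Prop :=
  Comp (fun p => f (fst p) (fst (snd p)) (snd (snd p))).

Section Basics.
Context {A B C D : Type} {EA : Enc A} {EB : Enc B} {EC : Enc C} {ED : Enc D}.

Lemma Comp_ext (f g : A -> B) : (forall a, f a = g a) -> Comp f -> Comp g.
Proof. intros E [h [H I]]. exists h. split; [exact H|]. intro a. now rewrite I, E. Qed.

Lemma Comp_id : Comp (fun a : A => a).
Proof. exists (fun n => n). split; [apply computable_id|reflexivity]. Qed.

Lemma Comp_const (b : B) : Comp (fun _ : A => b).
Proof. exists (fun _ => enc b). split; [apply computable_const|reflexivity]. Qed.

Lemma Comp_app1 (f : B -> C) (u : A -> B) :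
  Comp f -> Comp u -> Comp (fun a => f (u a)).
Proof.
  intros [h [H I]] [k [K J]]. exists (fun n => h (k n)).
  split; [now apply computable_comp|]. intro a. now rewrite J, I.
Qed.

Lemma Comp_pair (u : A -> B) (v : A -> C) :
  Comp u -> Comp v -> Comp (fun a => (u a, v a)).
Proof.
  intros [h [H I]] [k [K J]]. exists (fun n => cpair (h n) (k n)).
  split; [now apply computable_cpair|]. intro a. now rewrite I, J.
Qed.

Lemma Comp_fst : Comp (fun p : A * B => fst p).
Proof. exists cfst. split; [apply computable_cfst|]. intro. apply cfst_cpair. Qed.

Lemma Comp_snd : Comp (fun p : A * B => snd p).
Proof. exists csnd. split; [apply computable_csnd|]. intro. apply csnd_cpair. Qed.

Lemma Comp_enc : Comp (fun a : A => enc a).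
Proof. exists (fun n => n). split; [apply computable_id|reflexivity]. Qed.

Lemma Comp_succ : Comp S.
Proof. exists S. split; [apply computable_S|reflexivity]. Qed.

Lemma Comp_natrec (b : A -> B) (g : A -> nat -> B -> B) (n : A -> nat) :
  Comp b -> Comp3 g ->
  Comp n -> Comp (fun a => natrec (b a) (g a) (n a)).
Proof.
  intros [hb [Hb Ib]] [hg [Hg Ig]] [hn [Hn In]]. eexists.
  split; [exact (computable_natrec hb hg hn Hb Hg Hn)|].
  intro a. cbn beta. rewrite In. change (enc (n a)) with (n a).
  induction (n a) as [|m IH]; [apply Ib|].
  rewrite !natrec_S, IH. apply (Ig (a, (m, _))).
Qed.

Lemma Comp_if (b : A -> bool) (u v : A -> B) :
  Comp b -> Comp u -> Comp v -> Comp (fun a => if b a then u a else v a).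
Proof.
  intros [hb [Hb Ib]] [hu [Hu Iu]] [hv [Hv Iv]].
  exists (fun n => match hb n with 0 => hv n | S m => hu (cfst (cpair n m)) end).
  split.
  - apply (computable_case hv (fun m => hu (cfst m)) hb); auto.
    apply computable_comp; [exact Hu|apply computable_cfst].
  - intro a. rewrite Ib. destruct (b a); simpl; [rewrite cfst_cpair|]; auto.
Qed.

Lemma Comp_natcase (n : A -> nat) (u : A -> B) (v : A -> nat -> B) :
  Comp n -> Comp u -> Comp2 v ->
  Comp (fun a => match n a with 0 => u a | S m => v a m end).
Proof.
  intros [hn [Hn In]] [hu [Hu Iu]] [hv [Hv Iv]]. eexists.
  split; [exact (computable_case hu hv hn Hu Hv Hn)|].
  intro a. cbn beta. rewrite In. unfold enc at 1, Enc_nat.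
  destruct (n a) as [|m]; [apply Iu|apply (Iv (a, m))].
Qed.

Lemma Comp_listcase (l : A -> list B) (u : A -> C) (v : A -> B -> list B -> C) :
  Comp l -> Comp u ->
  Comp3 v ->
  Comp (fun a => match l a with [] => u a | h :: t => v a h t end).
Proof.
  intros [hl [Hl Il]] [hu [Hu Iu]] [hv [Hv Iv]]. eexists.
  split; [exact (computable_case hu hv hl Hu Hv Hl)|].
  intro a. cbn beta. rewrite Il. destruct (l a) as [|h t]; [apply Iu|].
  apply (Iv (a, (h, t))).
Qed.

Lemma Comp_cons : Comp2 (@cons A).
Proof.
  exists S. split; [apply computable_S|reflexivity].
Qed.

End Basics.

Section App.
Context {A B C D E : Type} {EA : Enc A} {EB : Enc B} {EC : Enc C} {ED : Enc D}
  {EE : Enc E}.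

Lemma Comp_app2 (f : B -> C -> D) (u : A -> B) (v : A -> C) :
  Comp2 f -> Comp u -> Comp v -> Comp (fun a => f (u a) (v a)).
Proof.
  intros F U V.
  exact (Comp_app1 (fun p => f (fst p) (snd p)) (fun a => (u a, v a)) F (Comp_pair u v U V)).
Qed.

Lemma Comp_app3 (f : B -> C -> D -> E) (u : A -> B) (v : A -> C) (w : A -> D) :
  Comp3 f -> Comp u -> Comp v -> Comp w -> Comp (fun a => f (u a) (v a) (w a)).
Proof.
  intros F U V W.
  exact (Comp_app1 (fun p => f (fst p) (fst (snd p)) (snd (snd p)))
           (fun a => (u a, (v a, w a))) F (Comp_pair _ _ U (Comp_pair _ _ V W))).
Qed.

End App.

Create HintDb comp.
#[global] Hint Resolve Comp_fst Comp_snd Comp_enc Comp_succ Comp_cons : comp.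

(* Composition with a function registered in the hint database, or the closure
   lemma of a higher-order operation; the latter are applied up to unfolding of
   definitions, so only the basic functions need to be registered. *)
Ltac comp_ho := fail.
Ltac comp_step :=
  cbv beta;
  match goal with
  | H : ?P |- ?P => exact H
  | |- _ => solve [auto with comp nocore]
  | |- Comp2 _ => unfold Comp2
  | |- Comp3 _ => unfold Comp3
  | |- Comp (fun x => x) => apply Comp_id
  | |- Comp (fun x => (_, _)) => apply Comp_pair
  | |- Comp (fun _ => ?c) => apply Comp_const
  | |- Comp (fun x => ?f (@?u x) (@?v x) (@?w x)) =>
      apply (Comp_app3 f u v w); [solve [auto with comp nocore]| | |]
  | |- Comp (fun x => ?f (@?u x) (@?v x)) =>
      apply (Comp_app2 f u v); [solve [auto with comp nocore]| |]
  | |- Comp (fun x => ?f (@?u x)) =>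
      apply (Comp_app1 f u); [solve [auto with comp nocore]|]
  | |- Comp (fun x => match _ with 0 => _ | S _ => _ end) => apply Comp_natcase
  | |- Comp (fun x => match _ with true => _ | false => _ end) => apply Comp_if
  | |- Comp (fun x => match _ with nil => _ | cons _ _ => _ end) => apply Comp_listcase
  | |- Comp (fun x => natrec _ _ _) => apply Comp_natrec
  | _ => comp_ho
  end.
Ltac comp := repeat comp_step.

Lemma Comp_add : Comp2 Nat.add.
Proof.
  apply Comp_ext with (f := fun p : nat * nat => natrec (snd p) (fun _ z => S z) (fst p)).
  - intros [n m]. induction n as [|n IH]; [reflexivity|].
    cbn [fst snd] in *. now rewrite natrec_S, IH.
  - comp.
Qed.
#[global] Hint Resolve Comp_add : comp.

Lemma Comp_pred : Comp Nat.pred.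
Proof. unfold Nat.pred. comp. Qed.
#[global] Hint Resolve Comp_pred : comp.

Lemma Comp_sub : Comp2 Nat.sub.
Proof.
  apply Comp_ext with (f := fun p : nat * nat => natrec (fst p) (fun _ z => pred z) (snd p)).
  - intros [n m]. cbn [fst snd]. induction m as [|m IH]; [symmetry; apply Nat.sub_0_r|].
    rewrite natrec_S, IH. lia.
  - comp.
Qed.
#[global] Hint Resolve Comp_sub : comp.

Lemma Comp_nat_eqb : Comp2 Nat.eqb.
Proof.
  apply Comp_ext with (f := fun p : nat * nat =>
    match (fst p - snd p) + (snd p - fst p) with 0 => true | S _ => false end).
  - intros [n m]. cbn [fst snd].
    destruct (Nat.eqb_spec n m); destruct (n - m + (m - n)) eqn:E; auto; lia.
  - comp.
Qed.
#[global] Hint Resolve Comp_nat_eqb : comp.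

Lemma Comp_negb : Comp negb.
Proof. unfold negb. comp. Qed.
Lemma Comp_andb : Comp2 andb.
Proof. unfold andb, Comp2. comp. Qed.
Lemma Comp_orb : Comp2 orb.
Proof. unfold orb, Comp2. comp. Qed.
#[global] Hint Resolve Comp_negb Comp_andb Comp_orb : comp.

(** The code of a list is a computable number of iterations that suffices to consume the list. *)
Lemma length_le_enc {A} {EA : Enc A} (l : list A) : length l <= enc l.
Proof.
  induction l as [|a l IH]; simpl; [lia|].
  change (enc (a :: l)) with (S (cpair (enc a) (enc l))).
  pose proof (le_cpair (enc a) (enc l)). lia.
Qed.

Section FoldLeft.
Context {A B C : Type} {EA : Enc A} {EB : Enc B} {EC : Enc C}.

Lemma Comp_fold_left (g : A -> C -> B -> C) (l : A -> list B) (i : A -> C) :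
  Comp3 g ->
  Comp l -> Comp i -> Comp (fun a => fold_left (g a) (l a) (i a)).
Proof.
  intros G L I.
  (* The state holds the accumulator and the unread rest; once the rest is empty the step idles, so
     surplus iterations are harmless. *)
  pose (stp := fun (a : A) (_ : nat) (s : C * list B) =>
    match snd s with [] => s | b :: t => (g a (fst s) b, t) end).
  apply Comp_ext with (f := fun a => fst (natrec (i a, l a) (stp a) (enc (l a)))).
  - intro a.
    assert (N : forall n l c, length l <= n ->
      natrec (c, l) (stp a) n = (fold_left (g a) l c, [])).
    (* [natrec] unfolds its last step, whereas the list is consumed from its first; [K] moves one
       step to the front. *)
    { assert (K : forall n l c, natrec (c, l) (stp a) (S n) =
                                natrec (stp a 0 (c, l)) (stp a) n).
      { induction n as [|n IHn]; intros; [reflexivity|].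
        change (natrec (c, l0) (stp a) (S (S n)))
          with (stp a (S n) (natrec (c, l0) (stp a) (S n))).
        now rewrite IHn. }
      induction n as [|n IHn]; intros l' c Hl.
      - destruct l'; [reflexivity|simpl in Hl; lia].
      - rewrite K. destruct l' as [|b l']; unfold stp at 1; cbn [snd fst].
        + now rewrite IHn by (simpl; lia).
        + simpl in Hl. now rewrite IHn by lia. }
    now rewrite N by apply length_le_enc.
  - subst stp. comp.
Qed.

End FoldLeft.

Lemma Comp_rev {A} {EA : Enc A} : Comp (@rev A).
Proof.
  apply Comp_ext with (f := fun l : list A => fold_left (fun r a => a :: r) l []).
  - assert (H : forall l r : list A,
      fold_left (fun r a => a :: r) l r = rev l ++ r).
    { induction l as [|a l IH]; intro r; [reflexivity|].
      simpl. now rewrite IH, <- app_assoc. }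
    intro l. now rewrite H, app_nil_r.
  - apply Comp_fold_left; comp.
Qed.
#[global] Hint Resolve Comp_rev : comp.

Section FoldRight.
Context {A B C : Type} {EA : Enc A} {EB : Enc B} {EC : Enc C}.

Lemma Comp_fold_right (g : A -> B -> C -> C) (l : A -> list B) (i : A -> C) :
  Comp3 g -> Comp l -> Comp i -> Comp (fun a => fold_right (g a) (i a) (l a)).
Proof.
  intros G L I.
  apply Comp_ext with (f := fun a => fold_left (fun c b => g a b c) (rev (l a)) (i a)).
  - intro a. now rewrite <- (fold_left_rev_right (g a)), rev_involutive.
  - apply Comp_fold_left; comp.
Qed.

End FoldRight.

Section Lists.
Context {A B C : Type} {EA : Enc A} {EB : Enc B} {EC : Enc C}.

Lemma Comp_map (f : A -> B -> C) (l : A -> list B) :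
  Comp2 f -> Comp l -> Comp (fun a => map (f a) (l a)).
Proof.
  intros F L.
  apply Comp_ext with (f := fun a => fold_right (fun b r => f a b :: r) [] (l a)).
  - intro a. induction (l a); simpl; congruence.
  - apply Comp_fold_right; comp.
Qed.

Lemma Comp_forallb (f : A -> B -> bool) (l : A -> list B) :
  Comp2 f -> Comp l -> Comp (fun a => forallb (f a) (l a)).
Proof.
  intros F L.
  apply Comp_ext with (f := fun a => fold_right (fun b r => f a b && r) true (l a)).
  - intro a. induction (l a); simpl; congruence.
  - apply Comp_fold_right; comp.
Qed.

Lemma Comp_existsb (f : A -> B -> bool) (l : A -> list B) :
  Comp2 f -> Comp l -> Comp (fun a => existsb (f a) (l a)).
Proof.
  intros F L.
  apply Comp_ext with (f := fun a => fold_right (fun b r => f a b || r) false (l a)).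
  - intro a. induction (l a); simpl; congruence.
  - apply Comp_fold_right; comp.
Qed.

Lemma Comp_app : Comp2 (@app A).
Proof.
  apply Comp_ext with (f := fun p : list A * list A => fold_right cons (snd p) (fst p)).
  - intros [l m]. cbn [fst snd]. induction l; simpl; congruence.
  - apply Comp_fold_right; comp.
Qed.

Lemma Comp_nth : Comp3 (@nth A).
Proof.
  apply Comp_ext with (f := fun p : nat * (list A * A) =>
    match natrec (fst (snd p)) (fun _ l => match l with [] => [] | _ :: t => t end) (fst p)
    with [] => snd (snd p) | h :: _ => h end).
  - intros [n [l d]]. cbn [fst snd].
    assert (H : forall m, natrec l (fun _ l => match l with [] => [] | _ :: t => t end) m
                          = skipn m l).
    { induction m as [|m IH]; [reflexivity|]. rewrite natrec_S, IH.
      clear. revert l. induction m as [|m IH]; intros [|h t]; try reflexivity.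
      apply (IH t). }
    rewrite H. clear H. revert l. induction n as [|n IH]; intros [|h t]; try reflexivity.
    apply IH.
  - comp.
Qed.

End Lists.
#[global] Hint Resolve Comp_app Comp_nth : comp.

Lemma Comp_seq : Comp2 seq.
Proof.
  apply Comp_ext with (f := fun p : nat * nat =>
    natrec [] (fun n l => l ++ [fst p + n]) (snd p)).
  - intros [s n]. cbn [fst snd]. induction n as [|n IH]; [reflexivity|].
    now rewrite natrec_S, IH, seq_S.
  - comp.
Qed.
#[global] Hint Resolve Comp_seq : comp.

Ltac comp_ho ::=
  first [ apply Comp_fold_left | apply Comp_fold_right | apply Comp_map
        | apply Comp_forallb | apply Comp_existsb ].

Lemma Comp_flat_map {A B C} {EA : Enc A} {EB : Enc B} {EC : Enc C}
  (f : A -> B -> list C) (l : A -> list B) :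
  Comp2 f -> Comp l -> Comp (fun a => flat_map (f a) (l a)).
Proof.
  intros F L. apply Comp_ext with (f := fun a => concat (map (f a) (l a))).
  - intro a. symmetry. apply flat_map_concat_map.
  - comp.
Qed.

(** * The encodings are inverse to the decoders, and recursion on terms is computable *)

Lemma term_nested_ind (P : term -> Prop) :
  (forall x, P (Var x)) -> (forall f ts, Forall P ts -> P (Fun f ts)) ->
  forall t, P t.
Proof.
  intros HV HF. fix IH 1. intros [x|f ts]; [apply HV|]. apply HF.
  induction ts as [|t ts IHts]; constructor; [apply IH|exact IHts].
Qed.

Lemma enc_Fun f ts : enc (Fun f ts) = S (2 * cpair f (enc ts)).
Proof. reflexivity. Qed.

Lemma enc_nil {A} {EA : Enc A} : enc (@nil A) = 0.
Proof. reflexivity. Qed.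

Lemma enc_list_cons {A} {EA : Enc A} (a : A) l : enc (a :: l) = S (cpair (enc a) (enc l)).
Proof. reflexivity. Qed.

Lemma enc_list_inj {A} {EA : Enc A} :
  (forall a b : A, enc a = enc b -> a = b) ->
  forall l m : list A, enc l = enc m -> l = m.
Proof.
  intro inj. induction l as [|a l IH]; intros [|b m];
    rewrite ?enc_list_cons, ?enc_nil; try congruence; try discriminate.
  intro K. injection K as K.
  pose proof (f_equal cfst K) as K1. pose proof (f_equal csnd K) as K2.
  rewrite !cfst_cpair in K1. rewrite !csnd_cpair in K2.
  f_equal; [now apply inj|now apply IH].
Qed.

Lemma enc_in_lt {A} {EA : Enc A} (a : A) l : In a l -> enc a < enc l.
Proof.
  induction l as [|b l IH]; [intros []|]. rewrite enc_list_cons.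
  pose proof (le_cpair (enc b) (enc l)). intros [->|H1]; [lia|]. apply IH in H1. lia.
Qed.

Lemma enc_arg_lt f ts t : In t ts -> enc t < enc (Fun f ts).
Proof.
  intro H. apply enc_in_lt in H. rewrite enc_Fun.
  pose proof (le_cpair f (enc ts)). lia.
Qed.

(** Components have smaller codes than the whole, so fuel exceeding the code still exceeds it in
    each recursive call. *)
Lemma dterm_enc t : forall fuel, enc t < fuel -> dterm fuel (enc t) = t.
Proof.
  induction t as [x|f ts IH] using term_nested_ind; intros [|fuel] Hf; try lia.
  - change (enc (Var x)) with (2 * x) in *. cbn [dterm].
    now rewrite Nat.even_even, Nat.div2_double.
  - rewrite enc_Fun in *. cbn [dterm].
    replace (Nat.even (S (2 * cpair f (enc ts)))) with false
      by (symmetry; rewrite Nat.even_succ; apply Nat.odd_even).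
    rewrite Nat.div2_succ_double, unpair_cpair.
    pose proof (le_cpair f (enc ts)). assert (Hl : enc ts < fuel) by lia. clear H Hf.
    f_equal. revert fuel Hl. induction IH as [|t ts Ht _ IHts]; intros [|fuel] Hl; try lia.
    + reflexivity.
    + rewrite enc_list_cons in *. cbn [dterms]. rewrite unpair_cpair.
      pose proof (le_cpair (enc t) (enc ts)).
      rewrite Ht, IHts by lia. reflexivity.
Qed.

Lemma decode_term_enc t : decode_term (enc t) = t.
Proof. apply dterm_enc. lia. Qed.

Lemma enc_dterm fuel : forall n, n < fuel ->
  enc (dterm fuel n) = n /\ enc (dterms fuel n) = n.
Proof.
  induction fuel as [|fuel IH]; intros n Hn; [lia|]. split.
  - cbn [dterm]. pose proof (Nat.div2_odd n) as D. rewrite <- Nat.negb_even in D.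
    destruct (Nat.even n); simpl negb in D; simpl Nat.b2n in D.
    + change (enc (Var (Nat.div2 n))) with (2 * Nat.div2 n). lia.
    + pose proof (cpair_unpair (Nat.div2 n)) as P.
      pose proof (le_cpair (cfst (Nat.div2 n)) (csnd (Nat.div2 n))) as L.
      unfold cfst, csnd in *. destruct (unpair (Nat.div2 n)) as [f l]. cbn [fst snd] in *.
      rewrite enc_Fun. destruct (IH l) as [_ ->]; lia.
  - cbn [dterms]. destruct n as [|n]; [reflexivity|].
    pose proof (cpair_unpair n) as P. pose proof (le_cpair (cfst n) (csnd n)) as L.
    unfold cfst, csnd in *. destruct (unpair n) as [h l]. cbn [fst snd] in *.
    rewrite enc_list_cons.
    destruct (IH h) as [-> _]; [lia|]. destruct (IH l) as [_ ->]; lia.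
Qed.

Lemma enc_decode_term n : enc (decode_term n) = n.
Proof. apply enc_dterm. lia. Qed.

Lemma enc_term_inj (s t : term) : enc s = enc t -> s = t.
Proof. intro E. now rewrite <- (decode_term_enc s), E, decode_term_enc. Qed.

Lemma dseq_enc (l : list nat) : forall fuel, enc l < fuel -> dseq fuel (enc l) = l.
Proof.
  induction l as [|a l IH]; intros [|fuel] Hf; try lia; [reflexivity|].
  rewrite enc_list_cons in *. cbn [dseq]. rewrite unpair_cpair.
  pose proof (le_cpair (enc a) (enc l)). rewrite IH by lia. reflexivity.
Qed.

Lemma enc_dseq fuel : forall n, n < fuel -> enc (dseq fuel n) = n.
Proof.
  induction fuel as [|fuel IH]; intros n Hn; [lia|].
  cbn [dseq]. destruct n as [|n]; [reflexivity|].
  pose proof (cpair_unpair n) as P. pose proof (le_cpair (cfst n) (csnd n)) as L.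
  unfold cfst, csnd in *. destruct (unpair n) as [h l]. cbn [fst snd] in *.
  rewrite enc_list_cons, IH by lia. unfold enc at 1, Enc_nat. lia.
Qed.

Lemma decode_rule_enc (r : rule) : decode_rule (enc r) = r.
Proof.
  destruct r as [l r]. unfold decode_rule.
  change (enc (l, r)) with (cpair (enc l) (enc r)).
  now rewrite unpair_cpair, !decode_term_enc.
Qed.

Lemma enc_decode_rule n : enc (decode_rule n) = n.
Proof.
  pose proof (cpair_unpair n) as P. unfold decode_rule, cfst, csnd in *.
  destruct (unpair n) as [a b].
  change (cpair (enc (decode_term a)) (enc (decode_term b)) = n).
  now rewrite !enc_decode_term.
Qed.

Lemma decode_trs_enc (R : trs) : decode_trs (enc R) = R.
Proof.
  unfold decode_trs, decode_seq.
  replace (enc R) with (enc (map enc R)).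
  - rewrite dseq_enc by lia. rewrite map_map. rewrite <- (map_id R) at 2.
    apply map_ext. apply decode_rule_enc.
  - induction R as [|r R IH]; [reflexivity|]. cbn [map].
    rewrite !enc_list_cons, IH. reflexivity.
Qed.

Lemma enc_decode_trs n : enc (decode_trs n : list (term * term)) = n.
Proof.
  transitivity (enc (decode_seq n)); [|apply enc_dseq; lia].
  unfold decode_trs, decode_seq.
  induction (dseq (S n) n) as [|a l IH]; [reflexivity|]. cbn [map].
  rewrite !enc_list_cons, IH, enc_decode_rule. reflexivity.
Qed.

(** On codes decoding is the identity: every number is the code of the term it decodes to. *)
Lemma Comp_decode_term : Comp decode_term.
Proof.
  exists (fun n => n). split; [apply computable_id|].
  intro n. symmetry. apply enc_decode_term.
Qed.

Lemma Comp_Var : Comp Var.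
Proof.
  apply Comp_ext with (f := fun x => decode_term (x + x)).
  - intro x. replace (x + x) with (2 * x) by lia. apply (decode_term_enc (Var x)).
  - pose proof Comp_decode_term. comp.
Qed.

Lemma computable_of_Comp (f : nat -> nat) : Comp f -> computable f.
Proof. intros [h [H I]]. eapply computable_ext; [exact I|exact H]. Qed.

Lemma Comp_Fun : Comp2 Fun.
Proof.
  exists (fun n => S (n + n)). split.
  - apply computable_of_Comp. comp.
  - intros [f ts]. cbn [fst snd]. rewrite enc_Fun.
    change (enc (f, ts)) with (cpair f (enc ts)). lia.
Qed.
#[global] Hint Resolve Comp_decode_term Comp_Var Comp_Fun : comp.

Lemma Comp_even : Comp Nat.even.
Proof.
  apply Comp_ext with (f := fun n => natrec true (fun _ b => negb b) n); [|comp].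
  intro n. induction n as [|n IH]; [reflexivity|].
  now rewrite natrec_S, IH, Nat.even_succ, Nat.negb_even.
Qed.

Lemma Comp_div2 : Comp Nat.div2.
Proof.
  pose proof Comp_even.
  apply Comp_ext with (f := fun n =>
    natrec 0 (fun k z => if Nat.even k then z else S z) n); [|comp].
  intro n. induction n as [|n IH]; [reflexivity|]. rewrite natrec_S, IH.
  pose proof (Nat.div2_odd n) as D. pose proof (Nat.div2_odd (S n)) as D'.
  rewrite Nat.odd_succ, <- Nat.negb_even in *.
  destruct (Nat.even n); simpl Nat.b2n in *; lia.
Qed.

(** Reads the half of an odd term code as a symbol with its arguments; again the identity on
    codes. *)
Definition decode_app (n : nat) : nat * list term :=
  (cfst n, dterms (S (csnd n)) (csnd n)).

Lemma decode_app_cpair f ts : decode_app (cpair f (enc ts)) = (f, ts).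
Proof.
  unfold decode_app. rewrite cfst_cpair, csnd_cpair. f_equal.
  apply (enc_list_inj enc_term_inj), enc_dterm. lia.
Qed.

Lemma Comp_decode_app : Comp decode_app.
Proof.
  exists (fun n => n). split; [apply computable_id|]. intro n.
  change (n = cpair (cfst n) (enc (dterms (S (csnd n)) (csnd n)))).
  destruct (enc_dterm (S (csnd n)) (csnd n)) as [_ ->]; [lia|].
  symmetry. apply cpair_unpair.
Qed.

Section TermCase.
Context {A B : Type} {EA : Enc A} {EB : Enc B}.

Lemma Comp_termcase (t : A -> term) (u : A -> nat -> B) (v : A -> nat -> list term -> B) :
  Comp t -> Comp2 u -> Comp3 v ->
  Comp (fun a => match t a with Var x => u a x | Fun f ts => v a f ts end).
Proof.
  intros T U V. pose proof Comp_even. pose proof Comp_div2. pose proof Comp_decode_app.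
  apply Comp_ext with (f := fun a =>
    if Nat.even (enc (t a)) then u a (Nat.div2 (enc (t a)))
    else v a (fst (decode_app (Nat.div2 (enc (t a)))))
             (snd (decode_app (Nat.div2 (enc (t a)))))); [|comp].
  intro a. destruct (t a) as [x|f ts].
  - change (enc (Var x)) with (2 * x). now rewrite Nat.even_even, Nat.div2_double.
  - rewrite enc_Fun.
    replace (Nat.even (S (2 * cpair f (enc ts)))) with false
      by (symmetry; rewrite Nat.even_succ; apply Nat.odd_even).
    now rewrite Nat.div2_succ_double, decode_app_cpair.
Qed.

End TermCase.

Ltac comp_ho ::=
  first [ apply Comp_fold_left | apply Comp_fold_right | apply Comp_map
        | apply Comp_forallb | apply Comp_existsb | apply Comp_flat_map
        | apply Comp_termcase ].

Section TermRec.
Context {A B : Type} {EA : Enc A} {EB : Enc B}.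

(* Course-of-values recursion on codes: the values on all smaller codes are
   kept in a table, the most recent one first. *)
Lemma Comp_termrec (F : A -> term -> B) (u : A -> nat -> B)
  (v : A -> nat -> list (term * B) -> B) :
  (forall a x, F a (Var x) = u a x) ->
  (forall a f ts, F a (Fun f ts) = v a f (map (fun t => (t, F a t)) ts)) ->
  Comp2 u -> Comp3 v -> Comp2 F.
Proof.
  intros FV FF U V.
  pose (table := fun a n => natrec []
    (fun k acc => match decode_term k with
                  | Var x => u a x
                  | Fun f ts =>
                      v a f (map (fun t => (t, nth (k - S (enc t)) acc (u a 0))) ts)
                  end :: acc) n).
  (* With the most recent value in front, code j stands at index [n - S j] of a table of length n.
     Arguments have smaller codes than their term, so each lookup at stage k hits an entry already
     present. *)
  assert (spec : forall a n j, j < n ->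
    nth (n - S j) (table a n) (u a 0) = F a (decode_term j)).
  { intros a. induction n as [|n IH]; intros j Hj; [lia|].
    unfold table. rewrite natrec_S. fold (table a n).
    destruct (Nat.eq_dec j n) as [->|Hne].
    - rewrite Nat.sub_diag. cbn [nth].
      pose proof (enc_decode_term n) as En.
      destruct (decode_term n) as [x|f ts]; [now rewrite FV|].
      rewrite FF. f_equal. apply map_ext_in. intros t Ht.
      apply (enc_arg_lt f) in Ht.
      now rewrite IH, decode_term_enc by lia.
    - replace (S n - S j) with (S (n - S j)) by lia. apply IH. lia. }
  apply Comp_ext with (f := fun p =>
    nth 0 (table (fst p) (S (enc (snd p)))) (u (fst p) 0)).
  - intros [a t]. cbn [fst snd].
    rewrite <- (decode_term_enc t) at 2. rewrite <- (spec a (S (enc t))) by lia.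
    now rewrite Nat.sub_diag.
  - unfold table. comp.
Qed.

End TermRec.

(** * The critical pair criterion *)

Lemma subst_ext_in s s' t :
  (forall x, In x (vars t) -> s x = s' x) -> subst s t = subst s' t.
Proof.
  induction t as [x|f ts IH] using term_nested_ind; simpl; intro H.
  - apply H. now left.
  - f_equal. apply map_ext_in. intros a Ha. rewrite Forall_forall in IH.
    apply IH; [exact Ha|]. intros x Hx. apply H, in_flat_map. eauto.
Qed.

Lemma subst_subst s s' t : subst s (subst s' t) = subst (fun x => subst s (s' x)) t.
Proof.
  induction t as [x|f ts IH] using term_nested_ind; simpl; [reflexivity|].
  f_equal. rewrite map_map. apply map_ext_in. now apply Forall_forall.
Qed.

Lemma subst_Var t : subst Var t = t.
Proof.
  induction t as [x|f ts IH] using term_nested_ind; simpl; [reflexivity|].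
  f_equal. rewrite <- (map_id ts) at 2. apply map_ext_in. now apply Forall_forall.
Qed.

Lemma in_vars_subst s t x :
  In x (vars (subst s t)) <-> exists y, In y (vars t) /\ In x (vars (s y)).
Proof.
  induction t as [y|f ts IH] using term_nested_ind; simpl.
  - split; [eauto|]. now intros [z [[->|[]] H]].
  - rewrite Forall_forall in IH. rewrite in_flat_map. split.
    + intros [a [Ha Hx]]. apply in_map_iff in Ha as [b [<- Hb]].
      apply IH in Hx as [y [Hy Hx]]; [|exact Hb].
      exists y. split; [apply in_flat_map; eauto|exact Hx].
    + intros [y [Hy Hx]]. apply in_flat_map in Hy as [b [Hb Hy]].
      exists (subst s b). split; [now apply in_map|]. apply IH; eauto.
Qed.

Definition joinable (R : trs) (a b : term) : Prop :=
  exists d, steps R a d /\ steps R b d.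

Section Steps.
Context (R : trs).

Lemma steps_refl t : steps R t t.
Proof. apply rt_refl. Qed.

Lemma steps_trans a b c : steps R a b -> steps R b c -> steps R a c.
Proof. apply rt_trans. Qed.

Lemma steps_step a b : step R a b -> steps R a b.
Proof. apply rt_step. Qed.

Lemma steps_ctx f pre post a b :
  steps R a b -> steps R (Fun f (pre ++ a :: post)) (Fun f (pre ++ b :: post)).
Proof.
  induction 1 as [a b H| |a b c _ IH1 _ IH2].
  - now apply steps_step, step_ctx.
  - apply steps_refl.
  - eapply steps_trans; eauto.
Qed.

Lemma steps_Fun f ts us : Forall2 (steps R) ts us -> steps R (Fun f ts) (Fun f us).
Proof.
  intro H. change ts with ([] ++ ts). change us with ([] ++ us).
  generalize (@nil term) as pre. induction H as [|t u ts us H _ IH]; intro pre.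
  - apply steps_refl.
  - eapply steps_trans; [apply steps_ctx, H|].
    specialize (IH (pre ++ [u])). now rewrite <- !app_assoc in IH.
Qed.

Lemma steps_subst_pointwise s s' t :
  (forall x, steps R (s x) (s' x)) -> steps R (subst s t) (subst s' t).
Proof.
  intro H. induction t as [x|f ts IH] using term_nested_ind; [apply H|].
  apply steps_Fun. induction IH; simpl; constructor; auto.
Qed.

Lemma step_subst s a b : step R a b -> step R (subst s a) (subst s b).
Proof.
  induction 1 as [l r s' Hin|f pre post a b H IH].
  - rewrite !subst_subst. now constructor.
  - simpl. rewrite !map_app. now constructor.
Qed.

Lemma steps_subst s a b : steps R a b -> steps R (subst s a) (subst s b).
Proof.
  induction 1 as [a b H| |a b c _ IH1 _ IH2].
  - now apply steps_step, step_subst.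
  - apply steps_refl.
  - eapply steps_trans; eauto.
Qed.

Lemma joinable_refl a : joinable R a a.
Proof. exists a. split; apply steps_refl. Qed.

Lemma joinable_sym a b : joinable R a b -> joinable R b a.
Proof. intros [d [H1 H2]]. now exists d. Qed.

Lemma joinable_subst s a b :
  joinable R a b -> joinable R (subst s a) (subst s b).
Proof. intros [d [H1 H2]]. exists (subst s d). split; now apply steps_subst. Qed.

Lemma joinable_steps a b a' b' :
  steps R a a' -> steps R b b' -> joinable R a' b' -> joinable R a b.
Proof. intros H1 H2 [d [H3 H4]]. exists d. split; eapply steps_trans; eauto. Qed.

Lemma joinable_ctx f pre post a b :
  joinable R a b -> joinable R (Fun f (pre ++ a :: post)) (Fun f (pre ++ b :: post)).
Proof. intros [d [H1 H2]]. eexists. split; apply steps_ctx; eassumption. Qed.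

End Steps.

(* [at_pos g t e c]: some subterm u of t has (e, w) among its candidates g u,
   and c is t with that occurrence of u replaced by w. *)
Inductive at_pos {E} (g : term -> list (E * term)) : term -> E -> term -> Prop :=
| at_here t e c : In (e, c) (g t) -> at_pos g t e c
| at_arg f pre post a e c :
    at_pos g a e c -> at_pos g (Fun f (pre ++ a :: post)) e (Fun f (pre ++ c :: post)).

(** As candidates for [at_pos] this singles out the function positions of a left-hand side, where
    critical overlaps arise; redexes below variables are joined separately. *)
Definition nonvar_occ (w u : term) : list (term * term) :=
  match u with Var _ => [] | Fun _ _ => [(u, w)] end.

(** Even and odd variables keep the two rules of an overlap apart, so that one substitution can
    instantiate both. *)
Definition ren_even (t : term) : term := subst (fun x => Var (2 * x)) t.
Definition ren_odd (t : term) : term := subst (fun x => Var (S (2 * x))) t.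

(** The critical peak before unification: [e] is a subterm of the outer left-hand side, to be
    unified with the inner left-hand side [t]; [a] results from the inner and [b] from the outer
    contraction. *)
Definition overlap (R : trs) (e a b t : term) : Prop :=
  exists l1 r1 l2 r2, In (l1, r1) R /\ In (l2, r2) R /\
    t = ren_odd l1 /\ b = ren_even r2 /\
    at_pos (nonvar_occ (ren_odd r1)) (ren_even l2) e a.

Definition overlaps_joinable (R : trs) : Prop :=
  forall e a b t, overlap R e a b t ->
  forall s, subst s e = subst s t -> joinable R (subst s a) (subst s b).

Section CriticalPairs.
Context (R : trs).

Lemma step_at_pos w l e c s :
  at_pos (nonvar_occ w) l e c -> step R (subst s e) (subst s w) ->
  step R (subst s l) (subst s c).
Proof.
  induction 1 as [t e c H|f pre post a e c _ IH]; intro St.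
  - destruct t; simpl in H; [tauto|]. destruct H as [H|[]]. now injection H as <- <-.
  - simpl. rewrite !map_app. apply step_ctx. now apply IH.
Qed.

Lemma weakly_confluent_overlaps : weakly_confluent R -> overlaps_joinable R.
Proof.
  intros W e a b t (l1 & r1 & l2 & r2 & H1 & H2 & -> & -> & Hat) s E.
  apply (W (subst s (ren_even l2))).
  - eapply step_at_pos; [exact Hat|]. rewrite E. unfold ren_odd.
    rewrite !subst_subst. now constructor.
  - unfold ren_even. rewrite !subst_subst. now constructor.
Qed.

Definition update (s : nat -> term) (x : nat) (v : term) (y : nat) : term :=
  if Nat.eqb y x then v else s y.

Lemma steps_update s x v :
  step R (s x) v -> forall y, steps R (s y) (update s x v y).
Proof.
  intros H y. unfold update. destruct (Nat.eqb_spec y x) as [->|].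
  - now apply steps_step.
  - apply steps_refl.
Qed.

(** A redex in an instance of [l] starts at a function position of [l] or lies inside the value of a
    variable x. In the first case [w] and [s'] stay open, so that they can later be the renamed
    right-hand side and a substitution serving both rules. In the second, rewriting the remaining
    copies of x as well leads to the instance under the updated substitution, also when [l] is not
    linear. *)
Lemma step_subst_cases l : forall s u, step R (subst s l) u ->
  (exists l1 r1 s1 e, In (l1, r1) R /\ subst s e = subst s1 l1 /\
     forall w s', (forall x, In x (vars l) -> s' x = s x) ->
       subst s' w = subst s1 r1 ->
       exists c, at_pos (nonvar_occ w) l e c /\ incl (vars e) (vars l) /\ subst s' c = u) \/
  (exists x v, step R (s x) v /\ steps R u (subst (update s x v) l)).
Proof.
  induction l as [x|f ts IH] using term_nested_ind; intros s u St.
  - right. exists x, u. split; [exact St|]. simpl. unfold update.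
    rewrite Nat.eqb_refl. apply steps_refl.
  - remember (subst s (Fun f ts)) as t eqn:Et.
    destruct St as [l1 r1 s1 Hin|g pre post a b St].
    + left. exists l1, r1, s1, (Fun f ts). repeat split; auto.
      intros w s' _ Hw. exists w. repeat split; auto using incl_refl.
      apply at_here. now left.
    + simpl in Et. injection Et as -> Et. symmetry in Et.
      apply map_eq_app in Et as (pre' & rest & -> & <- & Et).
      apply map_eq_cons in Et as (a' & post' & -> & <- & <-).
      apply Forall_elt in IH.
      destruct (IH s b St) as [(l1 & r1 & s1 & e & Hin & He & K)|(x & v & Hx & K)].
      * left. exists l1, r1, s1, e. repeat split; auto. intros w s' Ag Hw.
        destruct (K w s') as (c & Hc & Hi & <-).
        { intros x Hx. apply Ag. simpl. rewrite flat_map_app. simpl.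
          rewrite !in_app_iff. auto. }
        { exact Hw. }
        exists (Fun f (pre' ++ c :: post')). repeat split.
        -- now apply at_arg.
        -- intros x Hx. simpl. rewrite flat_map_app. simpl.
           rewrite !in_app_iff. auto.
        -- simpl. rewrite map_app. simpl. f_equal. f_equal.
           ++ apply map_ext_in. intros d Hd. apply subst_ext_in. intros x Hx.
              apply Ag. simpl. rewrite flat_map_app, in_app_iff. left.
              apply in_flat_map. eauto.
           ++ f_equal. apply map_ext_in. intros d Hd. apply subst_ext_in. intros x Hx.
              apply Ag. simpl. rewrite flat_map_app, in_app_iff. right. simpl.
              apply in_app_iff. right. apply in_flat_map. eauto.
      (* The argument containing the redex is covered by induction; its neighbours catch up by
         rewriting their own copies of x. *)
      * right. exists x, v. split; [exact Hx|]. simpl. rewrite map_app. simpl.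
        apply steps_Fun. apply Forall2_app; [|constructor; [exact K|]];
          (match goal with |- Forall2 _ _ (map _ ?l) => induction l end;
           simpl; constructor; auto;
           apply steps_subst_pointwise, steps_update, Hx).
Qed.

Lemma root_peak_joinable l r s u :
  overlaps_joinable R -> In (l, r) R -> step R (subst s l) u ->
  joinable R (subst s r) u.
Proof.
  intros OJ Hin St.
  (* [s0] undoes the even renaming, which turns the peak into one on an instance of [ren_even l]. *)
  pose (s0 := fun y => s (Nat.div2 y)).
  assert (El : forall t, subst s0 (ren_even t) = subst s t).
  { intro t. unfold ren_even, s0. rewrite subst_subst. apply subst_ext_in.
    intros x _. cbn [subst]. now rewrite Nat.div2_double. }
  rewrite <- (El l) in St.
  destruct (step_subst_cases _ _ _ St) as [(l1 & r1 & s1 & e & H1 & He & K)|(x & v & Hx & K)].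
  (* [s2] merges the two matching substitutions along the parity of the variables and so unifies the
     overlap. *)
  - pose (s2 := fun y => if Nat.even y then s (Nat.div2 y) else s1 (Nat.div2 y)).
    assert (Eo : forall t, subst s2 (ren_odd t) = subst s1 t).
    { intro t. unfold ren_odd, s2. rewrite subst_subst. apply subst_ext_in.
      intros x _. cbn [subst].
      replace (Nat.even (S (2 * x))) with false
        by (symmetry; rewrite Nat.even_succ; apply Nat.odd_even).
      now rewrite Nat.div2_succ_double. }
    assert (Ee : forall t, subst s2 (ren_even t) = subst s t).
    { intro t. unfold ren_even, s2. rewrite subst_subst. apply subst_ext_in.
      intros x _. cbn [subst]. now rewrite Nat.even_even, Nat.div2_double. }
    assert (Ag : forall x, In x (vars (ren_even l)) -> s2 x = s0 x).
    { intros x Hx. apply in_vars_subst in Hx as [y [_ [<-|[]]]].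
      unfold s2, s0. now rewrite Nat.even_even. }
    destruct (K (ren_odd r1) s2 Ag (Eo r1)) as (c & Hc & Hi & <-).
    apply joinable_sym. rewrite <- (Ee r).
    apply (OJ e c (ren_even r) (ren_odd l1)).
    + exists l1, r1, l, r. auto.
    + rewrite Eo, <- He. apply subst_ext_in. intros x Hx. apply Ag, Hi, Hx.
  (* Variable overlap: both sides move to the updated substitution, where a root step of the same
     rule closes the diagram. *)
  - eapply joinable_steps; [|exact K|].
    + rewrite <- El. apply steps_subst_pointwise, steps_update, Hx.
    + exists (subst (update s0 x v) (ren_even r)). split; [apply steps_refl|].
      unfold ren_even. rewrite !subst_subst. apply steps_step. now constructor.
Qed.

(** A peak with a root step is settled by the preceding lemma. Two steps inside arguments are joined
    by induction if they hit the same argument and commute otherwise. *)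
Lemma overlaps_weakly_confluent :
  overlaps_joinable R -> weakly_confluent R.
Proof.
  intros OJ t t1 t2 H1. revert t2.
  induction H1 as [l r s Hin|f pre post a b H1 IH]; intros t2 H2.
  - change (joinable R (subst s r) t2). eapply root_peak_joinable; eauto.
  - remember (Fun f (pre ++ a :: post)) as t eqn:Et.
    destruct H2 as [l r s Hin|g pre' post' a' b' H2].
    + apply joinable_sym. eapply root_peak_joinable; eauto. rewrite Et. now apply step_ctx.
    + injection Et as -> Et.
      (* [m] is the gap between the two splittings of the argument list; an empty gap means the same
         argument. *)
      apply app_eq_app in Et as [m [[-> Em]|[-> Em]]]; destruct m as [|x m];
        simpl in Em; injection Em as E1 E2; rewrite ?app_nil_r.
      * subst a' post'. apply joinable_ctx. exact (IH _ H2).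
      * subst x post. exists (Fun f (pre ++ b :: m ++ b' :: post')). split; apply steps_step.
        -- pose proof (step_ctx R f (pre ++ b :: m) post' a' b' H2) as K.
           now rewrite <- !app_assoc in K.
        -- rewrite <- app_assoc. now apply step_ctx.
      * subst a' post'. apply joinable_ctx. exact (IH _ H2).
      * subst x post'. exists (Fun f (pre' ++ b' :: m ++ b :: post)). split; apply steps_step.
        -- rewrite <- app_assoc. now apply step_ctx.
        -- pose proof (step_ctx R f (pre' ++ b' :: m) post a b H1) as K.
           now rewrite <- !app_assoc in K.
Qed.

End CriticalPairs.

(** * Unification *)

Definition term_eqb (s t : term) : bool := Nat.eqb (enc s) (enc t).

Lemma term_eqb_spec s t : reflect (s = t) (term_eqb s t).
Proof.
  unfold term_eqb. destruct (Nat.eqb_spec (enc s) (enc t)) as [E|E]; constructor.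
  - now apply enc_term_inj.
  - congruence.
Qed.

(* A unification problem together with the pair of terms to be instantiated by
   its solution. *)
Definition ustate : Type := (list (term * term) * (term * term))%type.

Definition unifies (s : nat -> term) (E : list (term * term)) : Prop :=
  forall p, In p E -> subst s (fst p) = subst s (snd p).

Definition instance_of (Q : ustate) (a b : term) : Prop :=
  exists s, unifies s (fst Q) /\ a = subst s (fst (snd Q)) /\ b = subst s (snd (snd Q)).

Definition subst1 (x : nat) (t u : term) : term :=
  subst (fun y => if Nat.eqb y x then t else Var y) u.

(** A fixed unsolvable problem marking failure; [ustep] maps it to itself. *)
Definition clash : list (term * term) := [(Fun 0 [], Fun 1 [])].

(** The solved equation is dropped and its binding carried out at once, also in the pair to be
    instantiated; thus no unifier has to be stored. The occurs check expects [t] to differ from the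
    variable itself, which [ustep] ensures. *)
Definition bind (x : nat) (t : term) (Q : ustate) : ustate :=
  if existsb (Nat.eqb x) (vars t) then (clash, snd Q)
  else (map (fun p => (subst1 x t (fst p), subst1 x t (snd p))) (fst Q),
        (subst1 x t (fst (snd Q)), subst1 x t (snd (snd Q)))).

(** Written by indexing, so that computability follows from that of [map], [nth] and [seq]; it is
    applied to lists of equal length. *)
Definition zip (ts us : list term) : list (term * term) :=
  map (fun i => (nth i ts (Var 0), nth i us (Var 0))) (seq 0 (length ts)).

Definition ustep (Q : ustate) : ustate :=
  match fst Q with
  | [] => Q
  | p :: E =>
      if term_eqb (fst p) (snd p) then (E, snd Q)
      else match fst p with
           | Var x => bind x (snd p) (E, snd Q)
           | Fun f ts =>
               match snd p with
               | Var y => bind y (fst p) (E, snd Q)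
               | Fun g us =>
                   if Nat.eqb f g && Nat.eqb (length ts) (length us)
                   then (zip ts us ++ E, snd Q) else (clash, snd Q)
               end
           end
  end.

Lemma zip_cons t ts u us : zip (t :: ts) (u :: us) = (t, u) :: zip ts us.
Proof.
  unfold zip. cbn [length seq map nth]. f_equal. rewrite <- seq_shift, map_map.
  reflexivity.
Qed.

Lemma not_unifies_clash s : ~ unifies s clash.
Proof. intro H. specialize (H _ (or_introl eq_refl)). discriminate. Qed.

Lemma unifies_cons s p E :
  unifies s (p :: E) <-> subst s (fst p) = subst s (snd p) /\ unifies s E.
Proof.
  unfold unifies. split.
  - intro H. split; [apply H; now left|]. intros q Hq. apply H. now right.
  - intros [H1 H2] q [<-|Hq]; auto.
Qed.

Lemma unifies_app s E F : unifies s (E ++ F) <-> unifies s E /\ unifies s F.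
Proof.
  unfold unifies. split.
  - intro H. split; intros p Hp; apply H, in_app_iff; auto.
  - intros [H1 H2] p Hp. apply in_app_iff in Hp as [Hp|Hp]; auto.
Qed.

Lemma unifies_zip s ts us : length ts = length us ->
  unifies s (zip ts us) <-> map (subst s) ts = map (subst s) us.
Proof.
  revert us. induction ts as [|t ts IH]; intros [|u us] L; try discriminate.
  - split; [reflexivity|]. intros _ p [].
  - rewrite zip_cons, unifies_cons, IH by (now injection L). cbn [map fst snd].
    split; [intros [-> ->]; reflexivity|]. intro E. injection E. auto.
Qed.

Lemma enc_vars_subst s x t : In x (vars t) -> enc (s x) <= enc (subst s t).
Proof.
  induction t as [y|f ts IH] using term_nested_ind.
  - intros [->|[]]. simpl. lia.
  - intro Hx. apply in_flat_map in Hx as [a [Ha Hx]]. rewrite Forall_forall in IH.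
    specialize (IH a Ha Hx).
    pose proof (enc_arg_lt f (map (subst s) ts) (subst s a) (in_map _ _ _ Ha)).
    change (subst s (Fun f ts)) with (Fun f (map (subst s) ts)). lia.
Qed.

(** The code serves as a size: an instance of a term properly containing x has a larger code than
    the value of x. *)
Lemma occurs_check s x t :
  In x (vars t) -> t <> Var x -> s x <> subst s t.
Proof.
  intros Hx Ht. destruct t as [y|f ts].
  - destruct Hx as [->|[]]. congruence.
  - apply in_flat_map in Hx as [a [Ha Hx]]. intro E.
    pose proof (enc_vars_subst s x a Hx).
    pose proof (enc_arg_lt f (map (subst s) ts) (subst s a) (in_map _ _ _ Ha)).
    rewrite E in H. change (subst s (Fun f ts)) with (Fun f (map (subst s) ts)) in H. lia.
Qed.

Lemma subst_subst1 s x t u : s x = subst s t -> subst s (subst1 x t u) = subst s u.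
Proof.
  intro E. unfold subst1. rewrite subst_subst. apply subst_ext_in. intros y _.
  destruct (Nat.eqb_spec y x) as [->|]; [now rewrite E|reflexivity].
Qed.

Lemma existsb_eqb_in x l : existsb (Nat.eqb x) l = true <-> In x l.
Proof.
  rewrite existsb_exists. split.
  - intros [y [Hy E]]. apply Nat.eqb_eq in E. now subst.
  - intro H. exists x. split; [exact H|apply Nat.eqb_refl].
Qed.

(** What is preserved is the set of instances of the pair, not the set of unifiers: a solution of
    the remaining equations may send x anywhere, and is corrected at x to the instance of [t]. *)
Lemma instance_of_bind x t E ab a b : t <> Var x ->
  instance_of (bind x t (E, ab)) a b <-> instance_of ((Var x, t) :: E, ab) a b.
Proof.
  intro Ht. unfold bind, instance_of. cbn [fst snd].
  destruct (existsb (Nat.eqb x) (vars t)) eqn:Ex; cbn [fst snd].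
  - apply existsb_eqb_in in Ex. split.
    + intros [s [H _]]. now apply not_unifies_clash in H.
    + intros [s [H _]]. apply unifies_cons in H as [H _].
      now apply (occurs_check s x t) in H.
  - assert (Nx : ~ In x (vars t)) by (rewrite <- existsb_eqb_in; congruence).
    split.
    + intros [s [H [-> ->]]].
      exists (fun y => subst s (if Nat.eqb y x then t else Var y)).
      assert (K : forall u, subst (fun y => subst s (if Nat.eqb y x then t else Var y)) u
                            = subst s (subst1 x t u)).
      { intro u. unfold subst1. now rewrite subst_subst. }
      rewrite !K. split; [|auto]. apply unifies_cons. split.
      * cbn [fst snd]. rewrite !K. unfold subst1. cbn [subst].
        rewrite Nat.eqb_refl. f_equal. symmetry. rewrite <- (subst_Var t) at 2.
        apply subst_ext_in. intros y Hy. destruct (Nat.eqb_spec y x); congruence.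
      * intros p Hp. rewrite !K.
        apply (H (subst1 x t (fst p), subst1 x t (snd p))).
        apply in_map_iff. exists p. auto.
    + intros [s [H [-> ->]]]. apply unifies_cons in H as [H1 H2]. cbn [fst snd subst] in H1.
      exists s. rewrite !(subst_subst1 s x t) by exact H1. split; [|auto].
      intros p Hp. apply in_map_iff in Hp as [q [<- Hq]]. cbn [fst snd].
      rewrite !(subst_subst1 s x t) by exact H1. now apply H2.
Qed.

Lemma instance_of_unifies_iff E F ab a b :
  (forall s, unifies s E <-> unifies s F) ->
  instance_of (E, ab) a b <-> instance_of (F, ab) a b.
Proof.
  intro H. unfold instance_of. cbn [fst snd].
  split; intros [s [K L]]; exists s; split; auto; now apply H.
Qed.

Lemma instance_of_ustep Q a b : instance_of (ustep Q) a b <-> instance_of Q a b.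
Proof.
  destruct Q as [[|[u v] E] ab]; unfold ustep; cbn [fst snd]; [reflexivity|].
  destruct (term_eqb_spec u v) as [->|Ne].
  - apply instance_of_unifies_iff. intro s. rewrite unifies_cons. tauto.
  - destruct u as [x|f ts].
    + apply instance_of_bind. congruence.
    + destruct v as [y|g us].
      * rewrite instance_of_bind by congruence. apply instance_of_unifies_iff.
        intro s. rewrite !unifies_cons. cbn [fst snd]. intuition.
      * destruct (Nat.eqb_spec f g) as [<-|Nf];
          [destruct (Nat.eqb_spec (length ts) (length us)) as [L|Nl]|];
          cbn [andb]; apply instance_of_unifies_iff; intro s.
        -- rewrite unifies_app, unifies_zip, unifies_cons by exact L. cbn [fst snd].
           split; intros [H1 H2]; (split; [|exact H2]).
           ++ simpl. now rewrite H1.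
           ++ now injection H1.
        -- rewrite unifies_cons. split; [intro H; now apply not_unifies_clash in H|].
           intros [H _]. injection H as H. apply (f_equal (@length _)) in H.
           rewrite !length_map in H. contradiction.
        -- rewrite unifies_cons. split; [intro H; now apply not_unifies_clash in H|].
           intros [H _]. injection H as H. contradiction.
Qed.

Definition usteps (n : nat) (Q : ustate) : ustate := natrec Q (fun _ Q => ustep Q) n.

Lemma usteps_succ n Q : usteps (S n) Q = usteps n (ustep Q).
Proof.
  unfold usteps. induction n as [|n IH]; [reflexivity|].
  rewrite natrec_S, IH. reflexivity.
Qed.

Lemma instance_of_usteps n Q a b : instance_of (usteps n Q) a b <-> instance_of Q a b.
Proof.
  revert Q. induction n as [|n IH]; intro Q; [reflexivity|].
  now rewrite usteps_succ, IH, instance_of_ustep.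
Qed.

Definition eqs_vars (E : list (term * term)) : list nat :=
  flat_map (fun p => vars (fst p) ++ vars (snd p)) E.

(** The successor per equation makes deleting a trivial equation a decrease; when arguments are
    zipped it is paid for by the successor in the code of each list cell. *)
Definition eqs_size (E : list (term * term)) : nat :=
  list_sum (map (fun p => S (enc (fst p) + enc (snd p))) E).

Lemma eqs_size_zip ts us : length ts = length us ->
  eqs_size (zip ts us) <= enc ts + enc us.
Proof.
  revert us. induction ts as [|t ts IH]; intros [|u us] L; try discriminate.
  - unfold eqs_size, zip. simpl. lia.
  - rewrite zip_cons, !enc_list_cons. injection L as L. specialize (IH us L).
    unfold eqs_size in *. cbn [map list_sum fold_right fst snd] in *.
    change (fold_right Nat.add 0) with list_sum.
    unfold cpair. pose proof (le_tri (enc t + enc ts)). pose proof (le_tri (enc u + enc us)).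
    lia.
Qed.

Lemma eqs_vars_zip ts us : length ts = length us ->
  incl (eqs_vars (zip ts us)) (flat_map vars ts ++ flat_map vars us).
Proof.
  revert us. induction ts as [|t ts IH]; intros [|u us] L; try discriminate.
  - intros x [].
  - rewrite zip_cons. injection L as L. specialize (IH us L). intros x Hx.
    simpl in *. rewrite !in_app_iff in *. destruct Hx as [Hx|Hx]; [tauto|].
    apply IH, in_app_iff in Hx. tauto.
Qed.

Lemma vars_subst1 x t u : ~ In x (vars t) ->
  forall y, In y (vars (subst1 x t u)) -> y <> x /\ (In y (vars t) \/ In y (vars u)).
Proof.
  intros Nx y Hy. apply in_vars_subst in Hy as [z [Hz Hy]].
  destruct (Nat.eqb_spec z x) as [->|Nz].
  - split; [congruence|auto].
  - destruct Hy as [->|[]]. auto.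
Qed.

Definition solved (Q : ustate) : Prop := fst Q = [] \/ fst Q = clash.

(** [V] is any list covering the variables, duplicates allowed. Binding eliminates x, so the list
    with x removed covers the new problem and is shorter; the first premise is the induction
    hypothesis of the termination proof. *)
Lemma usteps_bind_solved V x t E ab :
  (forall W E ab, length W < length V -> incl (eqs_vars E) W ->
     exists n, solved (usteps n (E, ab))) ->
  In x V -> incl (vars t) V -> incl (eqs_vars E) V ->
  exists n, solved (usteps n (bind x t (E, ab))).
Proof.
  intros IH Hx Ht HE. unfold bind. cbn [fst snd].
  destruct (existsb (Nat.eqb x) (vars t)) eqn:Ex.
  - exists 0. now right.
  - assert (Nx : ~ In x (vars t)) by (rewrite <- existsb_eqb_in; congruence).
    apply (IH (remove Nat.eq_dec x V)); [now apply remove_length_lt|].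
    intros y Hy. apply in_flat_map in Hy as [p [Hp Hy]].
    apply in_map_iff in Hp as [q [<- Hq]]. cbn [fst snd] in Hy.
    assert (K : y <> x /\ (In y (vars t) \/ In y (vars (fst q) ++ vars (snd q)))).
    { rewrite in_app_iff. apply in_app_iff in Hy as [Hy|Hy];
        apply vars_subst1 in Hy; tauto. }
    destruct K as [Ny K]. apply in_in_remove; [exact Ny|].
    destruct K as [K|K]; [now apply Ht|]. apply HE, in_flat_map. eauto.
Qed.

(* The number of variables still occurring decreases at each binding, the size
   of the problem at each other step. *)
Lemma usteps_terminates Q : exists n, solved (usteps n Q).
Proof.
  destruct Q as [E ab].
  assert (H : forall k V E ab, length V < k -> incl (eqs_vars E) V ->
    exists n, solved (usteps n (E, ab))).
  { induction k as [|k IHk]; [lia|].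
    intros V E0. remember (eqs_size E0) as m eqn:Em.
    assert (Hm : eqs_size E0 <= m) by lia. clear Em. revert E0 Hm.
    induction m as [m IHm] using lt_wf_ind. intros E0 Hm ab0 HV HE.
    destruct E0 as [|[u v] E0]; [exists 0; now left|].
    assert (step1 : (exists n, solved (usteps n (ustep ((u, v) :: E0, ab0)))) ->
                    exists n, solved (usteps n ((u, v) :: E0, ab0))).
    { intros [n Hn]. exists (S n). now rewrite usteps_succ. }
    apply step1. clear step1. unfold ustep. cbn [fst snd].
    assert (HE0 : incl (eqs_vars E0) V).
    { intros x Hx. apply HE. simpl. apply in_app_iff. now right. }
    assert (Hu : incl (vars u) V).
    { intros x Hx. apply HE. simpl. rewrite !in_app_iff. auto. }
    assert (Hv : incl (vars v) V).
    { intros x Hx. apply HE. simpl. rewrite !in_app_iff. auto. }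
    assert (Hs : S (enc u + enc v) + eqs_size E0 <= m) by exact Hm.
    destruct (term_eqb_spec u v) as [->|Ne].
    - apply (IHm (eqs_size E0)); auto; lia.
    - assert (IHk' : forall W E ab, length W < length V -> incl (eqs_vars E) W ->
        exists n, solved (usteps n (E, ab))).
      { intros W E1 ab1 HW. apply IHk. lia. }
      destruct u as [x|f ts].
      + apply usteps_bind_solved with V; auto. apply Hu. now left.
      + destruct v as [y|g us].
        * apply usteps_bind_solved with V; auto. apply Hv. now left.
        * destruct (Nat.eqb f g && Nat.eqb (length ts) (length us)) eqn:Ef;
            [|exists 0; now right].
          apply andb_true_iff in Ef as [_ L]. apply Nat.eqb_eq in L.
          assert (Hz : eqs_size (zip ts us ++ E0) =
                       eqs_size (zip ts us) + eqs_size E0).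
          { unfold eqs_size. now rewrite map_app, list_sum_app. }
          pose proof (eqs_size_zip ts us L).
          rewrite !enc_Fun in Hs.
          pose proof (le_cpair f (enc ts)). pose proof (le_cpair g (enc us)).
          apply (IHm (eqs_size (zip ts us ++ E0))); auto; [lia|].
          intros x Hx. unfold eqs_vars in Hx. rewrite flat_map_app in Hx.
          apply in_app_iff in Hx as [Hx|Hx]; [|now apply HE0].
          apply eqs_vars_zip in Hx; [|exact L].
          apply in_app_iff in Hx as [Hx|Hx]; [now apply Hu|now apply Hv]. }
  apply (H (S (length (eqs_vars E))) (eqs_vars E)); [lia|apply incl_refl].
Qed.

Lemma ustep_solved Q : solved Q -> ustep Q = Q.
Proof. destruct Q as [E ab]. now intros [H|H]; simpl in H; subst E. Qed.

(** Solved states are fixed points, which makes the check below monotone in its bound. *)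
Lemma usteps_solved_le n m Q : solved (usteps n Q) -> n <= m -> usteps m Q = usteps n Q.
Proof.
  intros H L. induction L as [|m L IH]; [reflexivity|].
  unfold usteps at 1. rewrite natrec_S. fold (usteps m Q).
  rewrite IH. now apply ustep_solved.
Qed.

(** * Semi-deciding weak confluence *)

(** All ways to replace one argument by one of its candidates. The fold also rebuilds the untouched
    argument list, and the input pairs arguments with their values, the form that recursion on terms
    supplies to [Comp_termrec]. *)
Definition arg_results {E} (l : list (term * list (E * term)))
  : list term * list (E * list term) :=
  fold_right (fun p st =>
    (fst p :: fst st,
     map (fun ec => (fst ec, snd ec :: fst st)) (snd p) ++
     map (fun el => (fst el, fst p :: snd el)) (snd st))) ([], []) l.

Fixpoint all_pos {E} (g : term -> list (E * term)) (t : term) : list (E * term) :=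
  match t with
  | Var _ => g t
  | Fun f ts =>
      g t ++ map (fun el => (fst el, Fun f (snd el)))
                 (snd (arg_results (map (fun t => (t, all_pos g t)) ts)))
  end.

Lemma arg_results_spec {E} (F : term -> list (E * term)) ts :
  fst (arg_results (map (fun t => (t, F t)) ts)) = ts /\
  forall e l, In (e, l) (snd (arg_results (map (fun t => (t, F t)) ts))) <->
    exists pre a post c, ts = pre ++ a :: post /\ In (e, c) (F a) /\ l = pre ++ c :: post.
Proof.
  induction ts as [|t ts [IH1 IH2]].
  - split; [reflexivity|]. simpl. intros e l. split; [tauto|].
    intros (pre & a & post & c & H & _). now destruct pre.
  - cbn [map arg_results fold_right fst snd].
    fold (arg_results (map (fun t => (t, F t)) ts)). rewrite IH1.
    split; [reflexivity|]. intros e l. rewrite in_app_iff, !in_map_iff. split.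
    + intros [[[e' c] [Eq Hc]]|[[e' l'] [Eq Hl]]]; injection Eq as <- <-.
      * exists [], t, ts, c. auto.
      * apply IH2 in Hl as (pre & a & post & c & -> & Hc & ->).
        exists (t :: pre), a, post, c. auto.
    + intros (pre & a & post & c & Eq & Hc & ->). destruct pre as [|b pre].
      * injection Eq as -> ->. left. exists (e, c). auto.
      * injection Eq as -> Eq. right. exists (e, pre ++ c :: post). split; [reflexivity|].
        apply IH2. exists pre, a, post, c. auto.
Qed.

Lemma all_pos_spec {E} (g : term -> list (E * term)) t : forall e c,
  In (e, c) (all_pos g t) <-> at_pos g t e c.
Proof.
  induction t as [x|f ts IH] using term_nested_ind; intros e c.
  - cbn [all_pos]. split; [apply at_here|]. intro H. now inversion H.
  - cbn [all_pos]. rewrite in_app_iff, in_map_iff.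
    destruct (arg_results_spec (all_pos g) ts) as [_ K]. rewrite Forall_forall in IH. split.
    + intros [H|[[e' l] [Eq H]]]; [now apply at_here|].
      injection Eq as <- <-. apply K in H as (pre & a & post & d & -> & Hd & ->).
      apply at_arg, IH; [apply in_elt|exact Hd].
    + intro H. inversion H as [? ? ? Hin|? pre post a ? d Hd]; subst; [now left|].
      right. exists (e, pre ++ d :: post). split; [reflexivity|]. apply K.
      exists pre, a, post, d. repeat split. apply IH; [apply in_elt|exact Hd].
Qed.

Definition lookup (s : list (nat * term)) (x : nat) : term :=
  fold_right (fun p r => if Nat.eqb (fst p) x then snd p else r) (Var x) s.

Definition assignments (xs : list nat) (ts : list term) : list (list (nat * term)) :=
  fold_right (fun x acc => flat_map (fun s => map (fun t => (x, t) :: s) ts) acc) [[]] xs.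

Fixpoint subterms (t : term) : list term :=
  t :: match t with Var _ => [] | Fun _ ts => flat_map subterms ts end.

(** Matching by exhaustion: a matching substitution sends the variables of the left-hand side to
    subterms of the redex, which leaves finitely many assignments. *)
Definition root_reducts (R : trs) (u : term) : list (term * term) :=
  flat_map (fun lr => flat_map (fun s =>
    if term_eqb (subst (lookup s) (fst lr)) u
    then [(u, subst (lookup s) (snd lr))] else [])
    (assignments (vars (fst lr)) (subterms u))) R.

Definition reducts (R : trs) (t : term) : list term :=
  map snd (all_pos (root_reducts R) t).

Lemma assignments_graph (s : nat -> term) xs ts :
  (forall x, In x xs -> In (s x) ts) -> In (map (fun x => (x, s x)) xs) (assignments xs ts).
Proof.
  induction xs as [|x xs IH]; intro H; [now left|].
  cbn [map assignments fold_right]. apply in_flat_map.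
  exists (map (fun x => (x, s x)) xs). split.
  - apply IH. intros y Hy. apply H. now right.
  - apply in_map_iff. exists (s x). split; [reflexivity|]. apply H. now left.
Qed.

Lemma lookup_graph (s : nat -> term) xs x :
  In x xs -> lookup (map (fun x => (x, s x)) xs) x = s x.
Proof.
  induction xs as [|y xs IH]; [intros []|]. intro H. cbn [map lookup fold_right fst snd].
  destruct (Nat.eqb_spec y x) as [->|N]; [reflexivity|].
  destruct H; [contradiction|]. now apply IH.
Qed.

Lemma subterms_self t : In t (subterms t).
Proof. destruct t; now left. Qed.

Lemma subterms_subst s l x : In x (vars l) -> In (s x) (subterms (subst s l)).
Proof.
  induction l as [y|f ts IH] using term_nested_ind.
  - intros [->|[]]. apply subterms_self.
  - intro H. apply in_flat_map in H as [a [Ha Hx]]. rewrite Forall_forall in IH.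
    right. simpl. apply in_flat_map. exists (subst s a). split; [now apply in_map|auto].
Qed.

Lemma root_reducts_spec R u e c : wf_trs R ->
  In (e, c) (root_reducts R u) <->
  e = u /\ exists l r s, In (l, r) R /\ u = subst s l /\ c = subst s r.
Proof.
  intro WF. unfold root_reducts. rewrite in_flat_map. split.
  - intros [[l r] [Hin H]]. apply in_flat_map in H as [s [_ H]]. cbn [fst snd] in H.
    destruct (term_eqb_spec (subst (lookup s) l) u) as [<-|]; [|destruct H].
    destruct H as [H|[]]. injection H as <- <-. split; [reflexivity|].
    exists l, r, (lookup s). auto.
  - intros [-> (l & r & s & Hin & -> & ->)]. exists (l, r). split; [exact Hin|].
    apply in_flat_map. exists (map (fun x => (x, s x)) (vars l)). cbn [fst snd]. split.
    + apply assignments_graph. intros x Hx. now apply subterms_subst.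
    + assert (H : forall t, incl (vars t) (vars l) ->
        subst (lookup (map (fun x => (x, s x)) (vars l))) t = subst s t).
      { intros t Ht. apply subst_ext_in. intros x Hx. apply lookup_graph, Ht, Hx. }
      rewrite !H; [|exact (proj2 (WF _ Hin))|apply incl_refl].
      destruct (term_eqb_spec (subst s l) (subst s l)); [now left|contradiction].
Qed.

Lemma reducts_spec R t u : wf_trs R -> In u (reducts R t) <-> step R t u.
Proof.
  intro WF. unfold reducts. rewrite in_map_iff. split.
  - intros [[e c] [<- H]]. cbn [snd]. apply all_pos_spec in H.
    induction H as [t e c H|f pre post a e c _ IH].
    + apply root_reducts_spec in H as [_ (l & r & s & Hin & -> & ->)]; [|exact WF].
      now constructor.
    + now constructor.
  - intro H. assert (K : exists e, at_pos (root_reducts R) t e u).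
    { induction H as [l r s Hin|f pre post a b _ [e IH]].
      - exists (subst s l). apply at_here. apply root_reducts_spec; eauto 8.
      - exists e. now apply at_arg. }
    destruct K as [e K]. exists (e, u). split; [reflexivity|]. now apply all_pos_spec.
Qed.

Definition reach (R : trs) (t : term) (n : nat) : list term :=
  natrec [t] (fun _ l => l ++ flat_map (reducts R) l) n.

Lemma reach_le R t n m : n <= m -> incl (reach R t n) (reach R t m).
Proof.
  intro L. induction L as [|m L IH]; [apply incl_refl|].
  unfold reach at 2. rewrite natrec_S. fold (reach R t m). now apply incl_appl.
Qed.

Lemma reach_spec R t u : wf_trs R -> (exists n, In u (reach R t n)) <-> steps R t u.
Proof.
  intro WF. split.
  - intros [n H]. revert u H. induction n as [|n IH]; intros u H.
    + destruct H as [<-|[]]. apply steps_refl.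
    + unfold reach in H. rewrite natrec_S in H. apply in_app_iff in H as [H|H]; [now apply IH|].
      apply in_flat_map in H as [v [Hv Hu]]. apply reducts_spec in Hu; [|exact WF].
      eapply steps_trans; [apply IH, Hv|now apply steps_step].
  - intro H. apply clos_rt_rtn1_iff in H. induction H as [|u v Huv _ [n IH]].
    + exists 0. now left.
    + exists (S n). unfold reach. rewrite natrec_S. apply in_app_iff. right.
      apply in_flat_map. exists u. split; [exact IH|]. now apply reducts_spec.
Qed.

Definition joinb (R : trs) (n : nat) (p : term * term) : bool :=
  existsb (fun d => existsb (term_eqb d) (reach R (snd p) n)) (reach R (fst p) n).

Lemma joinb_true R n a b :
  joinb R n (a, b) = true <-> exists d, In d (reach R a n) /\ In d (reach R b n).
Proof.
  unfold joinb. rewrite existsb_exists. split.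
  - intros [d [Hd H]]. apply existsb_exists in H as [d' [Hd' H]].
    destruct (term_eqb_spec d d') as [<-|]; [eauto|discriminate].
  - intros [d [H1 H2]]. exists d. split; [exact H1|]. apply existsb_exists.
    exists d. split; [exact H2|]. now destruct (term_eqb_spec d d).
Qed.

Lemma joinb_le R n m a b : n <= m -> joinb R n (a, b) = true -> joinb R m (a, b) = true.
Proof.
  intros L. rewrite !joinb_true. intros [d [H1 H2]].
  exists d. split; eapply reach_le; eauto.
Qed.

Lemma joinb_spec R a b : wf_trs R -> (exists n, joinb R n (a, b) = true) <-> joinable R a b.
Proof.
  intro WF. split.
  - intros [n H]. apply joinb_true in H as [d [H1 H2]].
    exists d. split; apply reach_spec; eauto.
  - intros [d [H1 H2]]. apply reach_spec in H1 as [n H1]; [|exact WF].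
    apply reach_spec in H2 as [m H2]; [|exact WF].
    exists (n + m). apply joinb_true. exists d.
    split; eapply reach_le; try eassumption; lia.
Qed.

(** Monotonicity merges finitely many searches into one: the sum of the individual bounds serves all
    of them. *)
Lemma forallb_eventually {A} (P : nat -> A -> bool) (l : list A) :
  (forall n m a, n <= m -> P n a = true -> P m a = true) ->
  (exists n, forallb (P n) l = true) <-> forall a, In a l -> exists n, P n a = true.
Proof.
  intro Mono. split.
  - intros [n H] a Ha. exists n. now apply (proj1 (forallb_forall _ _) H).
  - induction l as [|a l IH]; intro H; [now exists 0|].
    destruct (H a) as [n Hn]; [now left|].
    destruct IH as [m Hm]; [intros b Hb; apply H; now right|].
    exists (n + m). simpl. rewrite (Mono n) by (trivial; lia). simpl.
    rewrite forallb_forall in Hm |- *. intros b Hb. apply (Mono m); [lia|auto].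
Qed.

Definition local_peaks (R : trs) (t : term) : list (term * term) :=
  flat_map (fun a => map (fun b => (a, b)) (reducts R t)) (reducts R t).

Definition check_term (R : trs) (t : term) (n : nat) : bool :=
  forallb (joinb R n) (local_peaks R t).

Lemma check_term_spec R t : wf_trs R ->
  (exists n, check_term R t n = true) <-> weakly_confluent_on R t.
Proof.
  intro WF. unfold check_term.
  rewrite forallb_eventually by (intros n m []; apply joinb_le).
  split.
  - intros H t1 t2 H1 H2. apply joinb_spec; [exact WF|].
    apply (H (t1, t2)). unfold local_peaks. apply in_flat_map. exists t1.
    split; [now apply reducts_spec|]. apply in_map. now apply reducts_spec.
  - intros H [t1 t2] Hin. unfold local_peaks in Hin.
    apply in_flat_map in Hin as [a [Ha Hin]]. apply in_map_iff in Hin as [b [Eq Hb]].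
    injection Eq as <- <-. apply joinb_spec; [exact WF|].
    apply H; now apply (reducts_spec R).
Qed.

Definition overlap_problems (R : trs) : list ustate :=
  flat_map (fun q => flat_map (fun p => map (fun ec =>
      ([(fst ec, ren_odd (fst p))], (snd ec, ren_even (snd q))))
    (all_pos (nonvar_occ (ren_odd (snd p))) (ren_even (fst q)))) R) R.

Definition is_nil {A} (l : list A) : bool := match l with [] => true | _ :: _ => false end.

(** The bound limits both the unification and the joining sequences. A clash counts as success,
    having no instances; an unfinished unification counts as failure. *)
Definition check_problem (R : trs) (n : nat) (Q : ustate) : bool :=
  if is_nil (fst (usteps n Q))
  then joinb R n (snd (usteps n Q))
  else Nat.eqb (enc (fst (usteps n Q))) (enc clash).

Lemma enc_eqs_inj (E F : list (term * term)) : enc E = enc F -> E = F.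
Proof.
  apply enc_list_inj. intros p q H.
  rewrite <- (decode_rule_enc p), <- (decode_rule_enc q). now f_equal.
Qed.

Lemma check_problem_solved R n Q :
  check_problem R n Q = true -> solved (usteps n Q).
Proof.
  unfold check_problem, solved. destruct (usteps n Q) as [[|p E] ab]; cbn [is_nil fst snd].
  - auto.
  - intro H. right. apply Nat.eqb_eq in H. now apply enc_eqs_inj.
Qed.

Lemma check_problem_le R n m Q :
  n <= m -> check_problem R n Q = true -> check_problem R m Q = true.
Proof.
  intros L H. pose proof (check_problem_solved R n Q H) as So.
  unfold check_problem in *. rewrite (usteps_solved_le n m Q So L).
  destruct (is_nil _); [|exact H]. eapply joinb_le; eauto.
Qed.

(** A solved state without equations carries the most general critical pair: it is its own instance
    under [Var], and a join of it can be instantiated to join all others. *)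
Lemma check_problem_spec R Q : wf_trs R ->
  (exists n, check_problem R n Q = true) <->
  forall a b, instance_of Q a b -> joinable R a b.
Proof.
  intro WF. split.
  - intros [n H] a b Hab. apply (instance_of_usteps n) in Hab.
    pose proof (check_problem_solved R n Q H) as So. unfold check_problem in H.
    destruct (usteps n Q) as [E [c d]]. destruct Hab as [s [U [-> ->]]].
    cbn [fst snd is_nil] in *.
    destruct So as [So|So]; cbn [fst] in So; subst E.
    + apply joinable_subst, joinb_spec; [exact WF|]. now exists n.
    + now apply not_unifies_clash in U.
  - intro H. destruct (usteps_terminates Q) as [n So].
    assert (K : forall a b, instance_of (usteps n Q) a b -> joinable R a b).
    { intros a b Hab. apply H. now apply instance_of_usteps in Hab. }
    destruct (usteps n Q) as [E [c d]] eqn:EqS. destruct So as [So|So]; cbn [fst] in So; subst E.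
    + destruct (proj2 (joinb_spec R c d WF)) as [m Hm].
      { apply K. exists Var. cbn [fst snd]. rewrite !subst_Var. repeat split. intros p []. }
      exists (n + m). unfold check_problem.
      rewrite (usteps_solved_le n (n + m) Q); [|rewrite EqS; now left|lia].
      rewrite EqS. cbn [fst snd is_nil]. eapply joinb_le; [|exact Hm]. lia.
    + exists n. unfold check_problem. rewrite EqS. cbn [fst snd]. apply Nat.eqb_refl.
Qed.

Definition check_trs (R : trs) (n : nat) : bool :=
  forallb (check_problem R n) (overlap_problems R).

Lemma overlap_problems_spec R E ab :
  In (E, ab) (overlap_problems R) <->
  exists e t, E = [(e, t)] /\ overlap R e (fst ab) (snd ab) t.
Proof.
  unfold overlap_problems, overlap. rewrite in_flat_map. split.
  - intros [[l2 r2] [H2 H]]. apply in_flat_map in H as [[l1 r1] [H1 H]].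
    apply in_map_iff in H as [[e c] [Eq H]]. cbn [fst snd] in *.
    injection Eq as <- <-. apply all_pos_spec in H.
    exists e, (ren_odd l1). split; [reflexivity|]. exists l1, r1, l2, r2. auto.
  - intros (e & t & -> & l1 & r1 & l2 & r2 & H1 & H2 & -> & Eb & Hat).
    exists (l2, r2). split; [exact H2|]. apply in_flat_map. exists (l1, r1).
    split; [exact H1|]. apply in_map_iff. exists (e, fst ab). cbn [fst snd].
    rewrite <- Eb. split; [now destruct ab|]. now apply all_pos_spec.
Qed.

Lemma check_trs_spec R : wf_trs R ->
  (exists n, check_trs R n = true) <-> weakly_confluent R.
Proof.
  intro WF. unfold check_trs.
  rewrite forallb_eventually by (intros; eapply check_problem_le; eauto).
  transitivity (overlaps_joinable R).
  - split.
    + intros H e a b t O s Es.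
      apply (proj1 (check_problem_spec R ([(e, t)], (a, b)) WF)).
      * apply H. apply overlap_problems_spec. eauto.
      * exists s. repeat split. intros p [<-|[]]. exact Es.
    + intros H [E [a b]] HE. apply check_problem_spec; [exact WF|].
      apply overlap_problems_spec in HE as (e & t & -> & O).
      intros a' b' [s [U [-> ->]]]. apply (H _ _ _ _ O).
      apply (U (e, t)). now left.
  - split; [apply overlaps_weakly_confluent|apply weakly_confluent_overlaps].
Qed.

Definition is_var (t : term) : bool := match t with Var _ => true | Fun _ _ => false end.

Definition wf_trsb (R : trs) : bool :=
  forallb (fun p => negb (is_var (fst p)) &&
    forallb (fun x => existsb (Nat.eqb x) (vars (fst p))) (vars (snd p))) R.

Lemma wf_trsb_spec R : wf_trsb R = true <-> wf_trs R.
Proof.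
  unfold wf_trsb, wf_trs, wf_rule. rewrite forallb_forall.
  split; intros H p Hp; specialize (H p Hp).
  - apply andb_true_iff in H as [H1 H2]. rewrite forallb_forall in H2. split.
    + intros x E. now rewrite E in H1.
    + intros x Hx. now apply existsb_eqb_in, H2.
  - destruct H as [H1 H2]. apply andb_true_iff. split.
    + destruct (fst p) as [x|]; [now destruct (H1 x)|reflexivity].
    + apply forallb_forall. intros x Hx. now apply existsb_eqb_in, H2.
Qed.

(** * Computability of the checks and membership in the class *)

Section TermFunctions.
Context {A E : Type} {EA : Enc A} {EE : Enc E}.

Lemma Comp_subst (s : A -> nat -> term) (t : A -> term) :
  Comp2 s -> Comp t -> Comp (fun a => subst (s a) (t a)).
Proof.
  intros S T.
  assert (K : Comp2 (fun a t => subst (s a) t)).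
  { apply (Comp_termrec _ s (fun _ f l => Fun f (map snd l))); [| |exact S|comp].
    - reflexivity.
    - intros a f ts. simpl. now rewrite map_map. }
  exact (Comp_app2 _ (fun a => a) t K Comp_id T).
Qed.

Lemma Comp_arg_results : Comp (@arg_results E).
Proof. unfold arg_results. comp. Qed.

Lemma Comp_all_pos (g : A -> term -> list (E * term)) (t : A -> term) :
  Comp2 g -> Comp t -> Comp (fun a => all_pos (g a) (t a)).
Proof.
  intros G T. pose proof Comp_arg_results.
  assert (K : Comp2 (fun a t => all_pos (g a) t)).
  { apply (Comp_termrec _ (fun a x => g a (Var x)) (fun a f l =>
      g a (Fun f (map fst l)) ++
      map (fun el => (fst el, Fun f (snd el))) (snd (arg_results l)))); [| |comp|comp].
    - reflexivity.
    - intros a f ts. cbn [all_pos]. rewrite map_map. cbn [fst]. now rewrite map_id. }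
  exact (Comp_app2 _ (fun a => a) t K Comp_id T).
Qed.

End TermFunctions.

Lemma Comp_vars : Comp vars.
Proof.
  assert (K : Comp2 (fun (_ : nat) t => vars t)).
  { apply (Comp_termrec _ (fun _ x => [x]) (fun _ _ l => concat (map snd l)));
      [| |comp|comp].
    - reflexivity.
    - intros _ f ts. rewrite map_map. apply flat_map_concat_map. }
  exact (Comp_app2 _ (fun _ => 0) (fun t => t) K ltac:(comp) ltac:(comp)).
Qed.

Lemma Comp_subterms : Comp subterms.
Proof.
  assert (K : Comp2 (fun (_ : nat) t => subterms t)).
  { apply (Comp_termrec _ (fun _ x => [Var x])
      (fun _ f l => Fun f (map fst l) :: concat (map snd l))); [| |comp|comp].
    - reflexivity.
    - intros _ f ts. rewrite !map_map, map_id. cbn [subterms].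
      now rewrite flat_map_concat_map. }
  exact (Comp_app2 _ (fun _ => 0) (fun t => t) K ltac:(comp) ltac:(comp)).
Qed.
#[global] Hint Resolve Comp_vars Comp_subterms : comp.

Ltac comp_ho ::=
  first [ apply Comp_fold_left | apply Comp_fold_right | apply Comp_map
        | apply Comp_forallb | apply Comp_existsb | apply Comp_flat_map
        | apply Comp_termcase
        | apply Comp_subst | apply Comp_all_pos ].

Lemma Comp_term_eqb : Comp2 term_eqb.
Proof. unfold term_eqb, Comp2. comp. Qed.
#[global] Hint Resolve Comp_term_eqb : comp.

Lemma Comp_reach : Comp3 reach.
Proof. unfold reach, Comp3. comp. Qed.
#[global] Hint Resolve Comp_reach : comp.

Lemma Comp_is_nil {A} {EA : Enc A} : Comp (@is_nil A).
Proof. unfold is_nil. comp. Qed.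
#[global] Hint Resolve Comp_is_nil : comp.

Lemma Comp_bind : Comp3 bind.
Proof. unfold bind, Comp3, ustate. comp. Qed.
#[global] Hint Resolve Comp_bind : comp.

Lemma Comp_ustep : Comp ustep.
Proof. unfold ustep, ustate. comp. Qed.
#[global] Hint Resolve Comp_ustep : comp.

Lemma Comp_usteps : Comp2 usteps.
Proof. unfold usteps, Comp2. comp. Qed.
#[global] Hint Resolve Comp_usteps : comp.

Lemma Comp_check_problem : Comp3 check_problem.
Proof. unfold check_problem, Comp3. comp. Qed.
#[global] Hint Resolve Comp_check_problem : comp.

Lemma Comp_decode_trs : Comp decode_trs.
Proof.
  exists (fun n => n). split; [apply computable_id|]. intro n. symmetry. apply enc_decode_trs.
Qed.

Lemma Comp_cfst : Comp cfst.
Proof. exists cfst. split; [apply computable_cfst|reflexivity]. Qed.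

Lemma Comp_csnd : Comp csnd.
Proof. exists csnd. split; [apply computable_csnd|reflexivity]. Qed.
#[global] Hint Resolve Comp_decode_trs Comp_cfst Comp_csnd : comp.

Lemma Sigma01_check (B : nat -> Prop) (chk : nat -> nat -> bool) :
  Comp2 chk -> (forall n, B n <-> exists m, chk n m = true) -> Sigma01 B.
Proof.
  intros [h [[p Hp] I]] HB. exists (fun n m => chk n m = true). split; [|exact HB].
  exists (RComp p [rPair]). intros n m.
  assert (K : eval (RComp p [rPair]) [n; m] (if chk n m then 1 else 0)).
  { eapply eval_comp1; [apply eval_rPair|].
    replace (if chk n m then 1 else 0) with (h (cpair n m)) by exact (I (n, m)).
    apply Hp. }
  destruct (chk n m); split; intro H; congruence.
Qed.

Lemma Sigma01_WCR : Sigma01 WCR_set.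
Proof.
  apply Sigma01_check with (chk := fun n m =>
    wf_trsb (decode_trs n) && check_trs (decode_trs n) m); [comp|].
  intro n. unfold WCR_set. split.
  - intros [WF W]. apply check_trs_spec in W as [m Hm]; [|exact WF].
    exists m. apply wf_trsb_spec in WF. now rewrite WF, Hm.
  - intros [m H]. apply andb_true_iff in H as [H1 H2]. apply wf_trsb_spec in H1.
    split; [exact H1|]. apply check_trs_spec; eauto.
Qed.

Lemma Sigma01_WCR_term : Sigma01 WCR_term_set.
Proof.
  apply Sigma01_check with (chk := fun n m =>
    wf_trsb (decode_trs (cfst n)) &&
    check_term (decode_trs (cfst n)) (decode_term (csnd n)) m); [comp|].
  intro n. unfold WCR_term_set, cfst, csnd. destruct (unpair n) as [a b].
  cbn [fst snd]. split.
  - intros [WF W]. apply check_term_spec in W as [m Hm]; [|exact WF].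
    exists m. apply wf_trsb_spec in WF. now rewrite WF, Hm.
  - intros [m H]. apply andb_true_iff in H as [H1 H2]. apply wf_trsb_spec in H1.
    split; [exact H1|]. apply check_term_spec; eauto.
Qed.

Lemma Sigma01_WCR_ground : Sigma01 WCR_ground_set.
Proof.
  apply Sigma01_check with (chk := fun n m =>
    wf_trsb (decode_trs (cfst n)) && (is_nil (vars (decode_term (csnd n))) &&
    check_term (decode_trs (cfst n)) (decode_term (csnd n)) m)); [comp|].
  intro n. unfold WCR_ground_set, ground, cfst, csnd. destruct (unpair n) as [a b].
  cbn [fst snd]. split.
  - intros [WF [G W]]. apply check_term_spec in W as [m Hm]; [|exact WF].
    exists m. apply wf_trsb_spec in WF. now rewrite WF, G, Hm.
  - intros [m H]. apply andb_true_iff in H as [H1 H2]. apply andb_true_iff in H2 as [H2 H3].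
    apply wf_trsb_spec in H1. split; [exact H1|]. split.
    + now destruct (vars (decode_term b)).
    + apply check_term_spec; eauto.
Qed.

(** * A rewriting interpreter for recursive functions *)

Definition tStart : term := Fun 0 [].
Definition tEv (p a k : term) : term := Fun 1 [p; a; k].
Definition tRet (v k : term) : term := Fun 2 [v; k].
Definition tEvl (ps a k : term) : term := Fun 3 [ps; a; k].
Definition tRetl (vs k : term) : term := Fun 4 [vs; k].

Definition tZero : term := Fun 5 [].
Definition tSucc (x : term) : term := Fun 6 [x].
Definition tNil : term := Fun 7 [].
Definition tCons (h t : term) : term := Fun 8 [h; t].
Definition tRZero : term := Fun 9 [].
Definition tRSucc : term := Fun 10 [].
Definition tRProj (i : term) : term := Fun 11 [i].
Definition tRComp (f gs : term) : term := Fun 12 [f; gs].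
Definition tRPrec (f g : term) : term := Fun 13 [f; g].
Definition tRMu (f : term) : term := Fun 14 [f].
(** Continuation frames: [kArgs] keeps the programs of a list still to be run, [kCons] a value to be
    put in front of later ones, [kCall] the function awaiting its arguments, [kPrec] and [kMu] the
    state of a recursion and of a search. *)
Definition kArgs (gs a k : term) : term := Fun 15 [gs; a; k].
Definition kCons (v k : term) : term := Fun 16 [v; k].
Definition kCall (f k : term) : term := Fun 17 [f; k].
Definition kPrec (g n a k : term) : term := Fun 18 [g; n; a; k].
Definition kMu (f y a k : term) : term := Fun 19 [f; y; a; k].
Definition kTop : term := Fun 20 [].
Definition tAccept : term := Fun 21 [].

Fixpoint num (n : nat) : term :=
  match n with 0 => tZero | S k => tSucc (num k) end.

Definition tlist (l : list term) : term := fold_right tCons tNil l.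

Definition args (a : list nat) : term := tlist (map num a).

Fixpoint prog (p : recfun) : term :=
  match p with
  | RZero => tRZero
  | RSucc => tRSucc
  | RProj i => tRProj (num i)
  | RComp f gs => tRComp (prog f) (tlist (map prog gs))
  | RPrec f g => tRPrec (prog f) (prog g)
  | RMu f => tRMu (prog f)
  end.

Local Notation V := Var.

(* tEv p a k evaluates the program p on the arguments a with continuation k,
   tRet v k returns v to k; tEvl and tRetl do the same for lists of programs. *)
Definition machine : trs := [
  (tEv tRZero (V 0) (V 1), tRet tZero (V 1));
  (tEv tRSucc tNil (V 0), tRet (tSucc tZero) (V 0));
  (tEv tRSucc (tCons (V 0) (V 1)) (V 2), tRet (tSucc (V 0)) (V 2));
  (tEv (tRProj (V 0)) tNil (V 1), tRet tZero (V 1));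
  (tEv (tRProj tZero) (tCons (V 0) (V 1)) (V 2), tRet (V 0) (V 2));
  (tEv (tRProj (tSucc (V 3))) (tCons (V 0) (V 1)) (V 2), tEv (tRProj (V 3)) (V 1) (V 2));
  (tEv (tRComp (V 0) (V 1)) (V 2) (V 3), tEvl (V 1) (V 2) (kCall (V 0) (V 3)));
  (tEvl tNil (V 0) (V 1), tRetl tNil (V 1));
  (tEvl (tCons (V 0) (V 1)) (V 2) (V 3), tEv (V 0) (V 2) (kArgs (V 1) (V 2) (V 3)));
  (tRet (V 0) (kArgs (V 1) (V 2) (V 3)), tEvl (V 1) (V 2) (kCons (V 0) (V 3)));
  (tRetl (V 0) (kCons (V 1) (V 2)), tRetl (tCons (V 1) (V 0)) (V 2));
  (tRetl (V 0) (kCall (V 1) (V 2)), tEv (V 1) (V 0) (V 2));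
  (tEv (tRPrec (V 0) (V 1)) (tCons tZero (V 2)) (V 3), tEv (V 0) (V 2) (V 3));
  (tEv (tRPrec (V 0) (V 1)) (tCons (tSucc (V 4)) (V 2)) (V 3),
   tEv (tRPrec (V 0) (V 1)) (tCons (V 4) (V 2)) (kPrec (V 1) (V 4) (V 2) (V 3)));
  (tRet (V 0) (kPrec (V 1) (V 2) (V 3) (V 4)),
   tEv (V 1) (tCons (V 2) (tCons (V 0) (V 3))) (V 4));
  (tEv (tRMu (V 0)) (V 1) (V 2),
   tEv (V 0) (tCons tZero (V 1)) (kMu (V 0) tZero (V 1) (V 2)));
  (tRet tZero (kMu (V 0) (V 1) (V 2) (V 3)), tRet (V 1) (V 3));
  (tRet (tSucc (V 4)) (kMu (V 0) (V 1) (V 2) (V 3)),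
   tEv (V 0) (tCons (tSucc (V 1)) (V 2)) (kMu (V 0) (tSucc (V 1)) (V 2) (V 3)));
  (tRet (V 0) kTop, tAccept)].

Section Simulation.
Context (R : trs) (machine_R : incl machine R).

(** A rule is named by its index and a substitution by the list of values of [V 0], [V 1], and so
    on, so that single machine steps are verified by conversion. *)
Lemma machine_step i vs l r : nth_error machine i = Some (l, r) ->
  step R (subst (fun x => nth x vs (Var 0)) l) (subst (fun x => nth x vs (Var 0)) r).
Proof. intro H. apply step_root, machine_R. eapply nth_error_In, H. Qed.

Ltac run i vs t :=
  apply (steps_trans R _ t); [apply steps_step; exact (machine_step i vs _ _ eq_refl)|].

(** Index and argument list are peeled together; if the list ends early, the machine returns the
    same default 0 as [nth]. *)
Lemma eval_proj_steps i a k :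
  steps R (tEv (prog (RProj i)) (args a) k) (tRet (num (nth i a 0)) k).
Proof.
  revert a. induction i as [|i IH]; intros [|x a].
  - run 3 [num 0; k] (tRet tZero k). apply steps_refl.
  - run 4 [num x; args a; k] (tRet (num x) k). apply steps_refl.
  - run 3 [num (S i); k] (tRet tZero k). apply steps_refl.
  - run 5 [num x; args a; k; num i] (tEv (prog (RProj i)) (args a) k). apply IH.
Qed.

(** The moment at which the search is about to test the candidate [y]; these states are the
    checkpoints of a diverging search. *)
Definition mu_loop (f : recfun) (y : nat) (a : list nat) (k : term) : term :=
  tEv (prog f) (args (y :: a)) (kMu (prog f) (num y) (args a) k).

Lemma mu_loop_step f y a k v :
  step R (tRet (num (S v)) (kMu (prog f) (num y) (args a) k)) (mu_loop f (S y) a k).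
Proof. exact (machine_step 17 [prog f; num y; args a; k; num v] _ _ eq_refl). Qed.

Lemma mu_loop_start f a k : steps R (tEv (prog (RMu f)) (args a) k) (mu_loop f 0 a k).
Proof. run 15 [prog f; args a; k] (mu_loop f 0 a k). apply steps_refl. Qed.

(** Induction on derivations; the continuation is arbitrary because each subcomputation runs beneath
    a freshly pushed frame. *)
Lemma eval_steps : forall f a y, eval f a y ->
  forall k, steps R (tEv (prog f) (args a) k) (tRet (num y) k)
with eval_list_steps : forall gs a ys, eval_list gs a ys ->
  forall k, steps R (tEvl (tlist (map prog gs)) (args a) k) (tRetl (args ys) k).
Proof.
  - intros f a y [a0|a0|i a0|f0 gs a0 ys y0 Hl Hf|f0 g a0 y0 Hf|f0 g n a0 z y0 Hz Hg
      |f0 a0 y0 H0 Hlt] k.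
    + run 0 [args a0; k] (tRet tZero k). apply steps_refl.
    + destruct a0 as [|x a0].
      * run 1 [k] (tRet (tSucc tZero) k). apply steps_refl.
      * run 2 [num x; args a0; k] (tRet (tSucc (num x)) k). apply steps_refl.
    + apply eval_proj_steps.
    + run 6 [prog f0; tlist (map prog gs); args a0; k]
        (tEvl (tlist (map prog gs)) (args a0) (kCall (prog f0) k)).
      eapply steps_trans; [exact (eval_list_steps _ _ _ Hl _)|].
      run 11 [args ys; prog f0; k] (tEv (prog f0) (args ys) k).
      exact (eval_steps _ _ _ Hf k).
    + run 12 [prog f0; prog g; args a0; k] (tEv (prog f0) (args a0) k).
      exact (eval_steps _ _ _ Hf k).
    + run 13 [prog f0; prog g; args a0; k; num n]
        (tEv (prog (RPrec f0 g)) (args (n :: a0)) (kPrec (prog g) (num n) (args a0) k)).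
      eapply steps_trans; [exact (eval_steps _ _ _ Hz _)|].
      run 14 [num z; prog g; num n; args a0; k] (tEv (prog g) (args (n :: z :: a0)) k).
      exact (eval_steps _ _ _ Hg k).
    (* All tests before the result return a successor, so the loop reaches every candidate up to
       it. *)
    + assert (L : forall z, z <= y0 ->
        steps R (tEv (prog (RMu f0)) (args a0) k) (mu_loop f0 z a0 k)).
      { induction z as [|z IH]; intro Hz; [apply mu_loop_start|].
        eapply steps_trans; [apply IH; lia|].
        destruct (Hlt z Hz) as [[|v] [Nv Hv]]; [contradiction|].
        eapply steps_trans; [exact (eval_steps _ _ _ Hv _)|].
        apply steps_step, mu_loop_step. }
      eapply steps_trans; [apply (L y0), le_n|].
      eapply steps_trans; [exact (eval_steps _ _ _ H0 _)|].
      run 16 [prog f0; num y0; args a0; k] (tRet (num y0) k). apply steps_refl.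
  - intros gs a ys [a0|g gs0 a0 y ys0 Hg Hl] k.
    + run 7 [args a0; k] (tRetl tNil k). apply steps_refl.
    + run 8 [prog g; tlist (map prog gs0); args a0; k]
        (tEv (prog g) (args a0) (kArgs (tlist (map prog gs0)) (args a0) k)).
      eapply steps_trans; [exact (eval_steps _ _ _ Hg _)|].
      run 9 [num y; tlist (map prog gs0); args a0; k]
        (tEvl (tlist (map prog gs0)) (args a0) (kCons (num y) k)).
      eapply steps_trans; [exact (eval_list_steps _ _ _ Hl _)|].
      run 10 [args ys0; num y; k] (tRetl (args (y :: ys0)) k). apply steps_refl.
Qed.

End Simulation.

(* The symbols below 5 are those that head a left-hand side. *)
Fixpoint passive (t : term) : bool :=
  match t with
  | Var _ => true
  | Fun f ts => Nat.leb 5 f && forallb passive ts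
  end.

Lemma passive_subst s t :
  passive (subst s t) = true <->
  passive t = true /\ forall x, In x (vars t) -> passive (s x) = true.
Proof.
  induction t as [x|f ts IH] using term_nested_ind.
  - simpl. split; [intro H; split; [reflexivity|now intros y [<-|[]]]|].
    intros [_ H]. apply H. now left.
  - cbn [subst passive vars]. rewrite !andb_true_iff, !forallb_forall.
    rewrite Forall_forall in IH. split.
    + intros [Hf H]. repeat split; [exact Hf| |].
      * intros t Ht. apply (IH t Ht), H, in_map, Ht.
      * intros x Hx. apply in_flat_map in Hx as [t [Ht Hx]].
        apply (IH t Ht); [apply H, in_map, Ht|exact Hx].
    + intros [[Hf H1] H2]. split; [exact Hf|]. intros u Hu.
      apply in_map_iff in Hu as [t [<- Ht]]. apply (IH t Ht). split; [auto|].
      intros x Hx. apply H2, in_flat_map. eauto.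
Qed.

(** Checked pair by pair: left-hand sides of different rules clash at constructors, and equal
    instances of one left-hand side fix all variables of its right-hand side. *)
Lemma machine_unique l1 r1 l2 r2 s1 s2 :
  In (l1, r1) machine -> In (l2, r2) machine ->
  subst s1 l1 = subst s2 l2 -> subst s1 r1 = subst s2 r2.
Proof.
  intros H1 H2. simpl in H1, H2.
  repeat (destruct H1 as [H1|H1]; [injection H1 as <- <-|]); [..|destruct H1];
    (repeat (destruct H2 as [H2|H2]; [injection H2 as <- <-|]); [..|destruct H2]);
    simpl; intro E; try discriminate E; congruence.
Qed.

(** Closedness keeps the rule for [tStart] free of new variables and invariant under substitution;
    passivity rules out redexes inside the data of a configuration. *)
Lemma prog_constant p : vars (prog p) = [] /\ passive (prog p) = true.
Proof.
  assert (N : forall n, vars (num n) = [] /\ passive (num n) = true).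
  { induction n as [|n [IH1 IH2]]; [auto|]. cbn. now rewrite IH1, IH2. }
  revert p. fix IH 1. intros [| |i|f gs|f g|f]; cbn.
  - auto.
  - auto.
  - destruct (N i) as [-> ->]. auto.
  - destruct (IH f) as [-> ->].
    assert (G : vars (tlist (map prog gs)) = [] /\ passive (tlist (map prog gs)) = true).
    { induction gs as [|g gs [G1 G2]]; [auto|]. cbn. destruct (IH g) as [-> ->].
      cbn. fold (tlist (map prog gs)). now rewrite G1, G2. }
    destruct G as [G1 G2]. now rewrite G1, G2.
  - destruct (IH f) as [-> ->]. destruct (IH g) as [-> ->]. auto.
  - destruct (IH f) as [-> ->]. auto.
Qed.

Lemma num_constant n : vars (num n) = [] /\ passive (num n) = true.
Proof.
  destruct (prog_constant (RProj n)) as [H1 H2]. cbn in *.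
  rewrite app_nil_r in H1. now rewrite andb_true_r in H2.
Qed.

(** * The forked system: determinism, divergence and weak confluence *)

Definition init (p : recfun) (n : nat) : term := tEv (prog p) (args [n]) kTop.

Definition fork_trs (p : recfun) (n : nat) : trs :=
  (tStart, init p n) :: (tStart, tAccept) :: machine.

Section Fork.
Context (p : recfun) (n : nat).
Notation R := (fork_trs p n).

Lemma machine_fork : incl machine R.
Proof. intros r H. now do 2 right. Qed.

Lemma vars_init : vars (init p n) = [].
Proof.
  destruct (prog_constant p) as [H1 _]. destruct (num_constant n) as [H2 _].
  cbn. now rewrite H1, H2.
Qed.

(** Any head except that of [tStart], with passive arguments: only the root can be a redex.
    [tAccept] is included, so that whole runs stay within the invariant. *)
Definition is_state (t : term) : Prop :=
  exists f ts, t = Fun f ts /\ 1 <= f /\ forallb passive ts = true.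

Lemma is_state_init : is_state (init p n).
Proof.
  destruct (prog_constant p) as [_ H1]. destruct (num_constant n) as [_ H2].
  exists 1, [prog p; args [n]; kTop]. repeat split; [lia|]. cbn. now rewrite H1, H2.
Qed.

Lemma machine_rule_shape l r : In (l, r) machine ->
  (exists f ts, l = Fun f ts /\ 1 <= f < 5 /\ forallb passive ts = true) /\
  is_state r /\ incl (vars r) (vars l).
Proof.
  assert (W : wf_trs machine) by (apply wf_trsb_spec; reflexivity).
  intro H. split; [|split; [|exact (proj2 (W _ H))]]; simpl in H;
    repeat (destruct H as [H|H]; [injection H as <- <-|]); try contradiction;
    (do 2 eexists; split; [reflexivity|split; [lia|reflexivity]]).
Qed.

Lemma fork_rule_shape l r : In (l, r) R ->
  exists f ts, l = Fun f ts /\ f < 5 /\ forallb passive ts = true.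
Proof.
  intros [H|[H|H]].
  - injection H as <- _. exists 0, []. auto with arith.
  - injection H as <- _. exists 0, []. auto with arith.
  - apply machine_rule_shape in H as [(f & ts & -> & Hf & Ht) _]. exists f, ts.
    repeat split; [lia|exact Ht].
Qed.

Lemma wf_fork : wf_trs R.
Proof.
  intros r [<-|[<-|H]].
  - split; [discriminate|]. cbn [fst snd]. now rewrite vars_init.
  - split; [discriminate|intros x []].
  - revert r H. apply wf_trsb_spec. reflexivity.
Qed.

Lemma passive_normal t u : passive t = true -> ~ step R t u.
Proof.
  intros Ht St. induction St as [l r s Hin|f pre post a b St IH].
  - apply fork_rule_shape in Hin as (f & ts & -> & Hf & _).
    apply andb_true_iff in Ht as [Ht _]. apply Nat.leb_le in Ht. lia.
  - apply andb_true_iff in Ht as [_ Ht]. rewrite forallb_forall in Ht.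
    apply IH, Ht, in_elt.
Qed.

(** Passive arguments force a root step, and the head forces a machine rule. The values of its
    variables occur inside the passive arguments, so they are passive and the result is a state
    again. *)
Lemma state_step t u : is_state t -> step R t u ->
  is_state u /\ exists l r s, In (l, r) machine /\ t = subst s l /\ u = subst s r.
Proof.
  intros (f & ts & -> & Hf & Ht) St.
  remember (Fun f ts) as t eqn:Et. destruct St as [l r s Hin|g pre post a b St].
  - destruct Hin as [H|[H|H]].
    + injection H as <- <-. injection Et as <- _. lia.
    + injection H as <- <-. injection Et as <- _. lia.
    + split; [|eauto 8].
      apply machine_rule_shape in H as [(h & ls & -> & _ & Hl) [(g & rs & -> & Hg & Hr) Hv]].
      injection Et as -> <-.
      exists g, (map (subst s) rs). repeat split; [exact Hg|].
      assert (Hs : forall x, In x (flat_map vars ls) -> passive (s x) = true).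
      { intros x Hx. apply in_flat_map in Hx as [a [Ha Hx]].
        rewrite forallb_forall in Ht. specialize (Ht _ (in_map (subst s) _ _ Ha)).
        apply passive_subst in Ht as [_ Ht]. now apply Ht. }
      rewrite forallb_forall in Hr |- *. intros b Hb.
      apply in_map_iff in Hb as [a [<- Ha]]. apply passive_subst. split; [now apply Hr|].
      intros x Hx. apply Hs, Hv. cbn [vars]. apply in_flat_map. eauto.
  - injection Et as -> <-. rewrite forallb_forall in Ht.
    exfalso. eapply passive_normal; [|exact St]. apply Ht, in_elt.
Qed.

Lemma state_step_unique t u v : is_state t -> step R t u -> step R t v -> u = v.
Proof.
  intros Ht Hu Hv.
  destruct (state_step t u Ht Hu) as [_ (l & r & s & Hl & E & ->)].
  destruct (state_step t v Ht Hv) as [_ (l' & r' & s' & Hl' & E' & ->)].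
  eapply machine_unique; eauto. congruence.
Qed.

(** Counting the steps allows two runs from the same state to be compared. *)
Fixpoint nsteps (k : nat) (t u : term) : Prop :=
  match k with 0 => t = u | S k => exists v, step R t v /\ nsteps k v u end.

Lemma steps_nsteps t u : steps R t u -> exists k, nsteps k t u.
Proof.
  intro H. apply clos_rt_rt1n_iff in H. induction H as [t|t u v Hu _ [k IH]].
  - now exists 0.
  - exists (S k). now exists u.
Qed.

Lemma nsteps_app j k t u v : nsteps j t u -> nsteps k u v -> nsteps (j + k) t v.
Proof.
  revert t. induction j as [|j IH]; intros t H K; simpl in *; [now subst|].
  destruct H as [w [Hw H]]. eauto.
Qed.

Lemma nsteps_cancel j k t u v :
  is_state t -> nsteps j t u -> nsteps (j + k) t v -> nsteps k u v.
Proof.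
  revert t. induction j as [|j IH]; intros t Ht H K; simpl in *; [now subst|].
  destruct H as [w [Hw H]]. destruct K as [w' [Hw' K]].
  rewrite <- (state_step_unique t w w' Ht Hw Hw') in K.
  apply (IH w); auto. eapply state_step; eauto.
Qed.

Lemma nsteps_state j t u : is_state t -> nsteps j t u -> is_state u.
Proof.
  revert t. induction j as [|j IH]; intros t Ht H; simpl in *; [now subst|].
  destruct H as [w [Hw H]]. eapply IH; [|exact H]. eapply state_step; eauto.
Qed.

(** By determinism a run to [tAccept] either passes the next checkpoint, which leaves a strictly
    shorter run from there, or ends before it, in which case the normal form [tAccept] would have to
    step on. *)
Lemma infinite_run_not_accept (L : nat -> term) :
  is_state (L 0) -> (forall m, exists j, nsteps (S j) (L m) (L (S m))) ->
  forall k, ~ nsteps k (L 0) tAccept.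
Proof.
  intros H0 HL.
  assert (HS : forall m, is_state (L m)).
  { induction m as [|m IH]; [exact H0|]. destruct (HL m) as [j Hj].
    eapply nsteps_state; eauto. }
  assert (K : forall k m, ~ nsteps k (L m) tAccept); [|intro k; apply K].
  induction k as [k IH] using lt_wf_ind. intros m Hk. destruct (HL m) as [j Hj].
  destruct (le_lt_dec (S j) k) as [Hle|Hlt].
  - apply (IH (k - S j)) with (m := S m); [lia|].
    apply (nsteps_cancel (S j) _ (L m)); auto.
    now replace (S j + (k - S j)) with k by lia.
  - assert (C : nsteps (S (j - k)) tAccept (L (S m))).
    { apply (nsteps_cancel k _ (L m)); auto.
      now replace (k + S (j - k)) with (S j) by lia. }
    destruct C as [w [Hw _]]. eapply passive_normal; [|exact Hw]. reflexivity.
Qed.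

Lemma mu_diverges f : p = RMu f ->
  (forall m, exists v, eval f [m; n] (S v)) -> ~ steps R (init p n) tAccept.
Proof.
  intros Ep Hv H. apply steps_nsteps in H as [k Hk].
  pose (L := fun m => mu_loop f m [n] kTop).
  assert (HL : forall m, exists j, nsteps (S j) (L m) (L (S m))).
  { intro m. destruct (Hv m) as [v Ev].
    apply (eval_steps R machine_fork) with (k := kMu (prog f) (num m) (args [n]) kTop) in Ev.
    apply steps_nsteps in Ev as [j Hj]. exists j.
    replace (S j) with (j + 1) by lia. eapply nsteps_app; [exact Hj|].
    eexists. split; [apply (mu_loop_step R machine_fork)|reflexivity]. }
  pose proof (mu_loop_start R machine_fork f [n] kTop) as Hs. rewrite <- Ep in Hs.
  apply steps_nsteps in Hs as [i Hi].
  (* The initial configuration is put in front of the loop states; its continuation is [kTop] and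
     not a [kMu] frame, so the segment to the first loop state is not empty. *)
  apply (infinite_run_not_accept (fun m => match m with 0 => init p n | S m => L m end))
    with (k := k).
  - apply is_state_init.
  - intros [|m]; [|apply HL]. destruct (HL 0) as [j Hj].
    destruct i as [|i]; [|now exists i].
    discriminate Hi.
  - exact Hk.
Qed.

(** Below the root left-hand sides contain only passive symbols, so all overlaps are at the root.
    Those between machine rules are trivial by [machine_unique], and [tStart] matches no machine
    rule, which leaves the two rules for [tStart]. *)
Lemma fork_weakly_confluent : steps R (init p n) tAccept -> weakly_confluent R.
Proof.
  intro Hacc. apply overlaps_weakly_confluent.
  intros e a b t (l1 & r1 & l2 & r2 & H1 & H2 & -> & -> & Hat) s E.
  assert (Er : e = ren_even l2 /\ a = ren_odd r1).
  { destruct (fork_rule_shape _ _ H1) as (f1 & ts1 & -> & Hf1 & _).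
    destruct (fork_rule_shape _ _ H2) as (f2 & ts2 & -> & _ & Hp2).
    (* A function position below the root carries a symbol from 5 on, which cannot equal the head of
       the inner left-hand side. *)
    assert (Sub : forall w t e c, at_pos (nonvar_occ w) t e c -> passive t = true ->
      exists g us, e = Fun g us /\ 5 <= g).
    { intros w t e' c Hat'. induction Hat' as [t e' c Hin|f pre post x e' c _ IH]; intro Hp.
      - destruct t as [|g us]; [destruct Hin|]. destruct Hin as [Hin|[]].
        injection Hin as <- <-. exists g, us. split; [reflexivity|].
        apply andb_true_iff in Hp as [Hp _]. now apply Nat.leb_le.
      - apply IH. apply andb_true_iff in Hp as [_ Hp]. rewrite forallb_forall in Hp.
        apply Hp, in_elt. }
    remember (ren_even (Fun f2 ts2)) as l eqn:El.
    destruct Hat as [t e c Hin|f pre post x e c Hx].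
    - subst t. destruct Hin as [Hin|[]]. now injection Hin as <- <-.
    - exfalso. injection El as <- El.
      assert (Hp : passive x = true).
      { pose proof (in_elt x pre post) as Hin. rewrite El in Hin.
        apply in_map_iff in Hin as [y [<- Hy]]. apply passive_subst.
        rewrite forallb_forall in Hp2. split; [now apply Hp2|reflexivity]. }
      destruct (Sub _ _ _ _ Hx Hp) as (g & us & -> & Hg).
      injection E as -> _. lia. }
  destruct Er as [-> ->]. unfold ren_even, ren_odd in *. rewrite !subst_subst in *.
  (* With the renamings absorbed, the unifier becomes two arbitrary substitutions, one for each
     rule. *)
  revert E. generalize (fun x => subst s (Var (S (2 * x)))), (fun x => subst s (Var (2 * x))).
  intros s1 s2 E.
  assert (Hinit : forall s, subst s (init p n) = init p n).
  { intro s'. rewrite <- (subst_Var (init p n)) at 2. apply subst_ext_in.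
    rewrite vars_init. intros x []. }
  assert (Clash : forall l r s1 s2, In (l, r) machine -> subst s1 tStart = subst s2 l -> False).
  { intros l r t1 t2 Hl El. apply machine_rule_shape in Hl as [(f & ts & -> & Hf & _) _].
    injection El as <- _. lia. }
  destruct H1 as [H1|[H1|H1]]; destruct H2 as [H2|[H2|H2]];
    try (injection H1 as <- <-); try (injection H2 as <- <-);
    rewrite ?Hinit; try apply joinable_refl.
  - exists tAccept. split; [exact Hacc|apply steps_refl].
  - destruct (Clash _ _ _ _ H2 (eq_sym E)).
  - exists tAccept. split; [apply steps_refl|exact Hacc].
  - destruct (Clash _ _ _ _ H2 (eq_sym E)).
  - destruct (Clash _ _ _ _ H1 E).
  - destruct (Clash _ _ _ _ H1 E).
  - rewrite (machine_unique _ _ _ _ _ _ H1 H2 (eq_sym E)). apply joinable_refl.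
Qed.

(** [tAccept] is a normal form, hence itself the only possible common reduct. *)
Lemma fork_accepts : weakly_confluent_on R tStart -> steps R (init p n) tAccept.
Proof.
  intro W.
  destruct (W (init p n) tAccept) as [d [H1 H2]].
  - rewrite <- (subst_Var (init p n)).
    exact (step_root R tStart (init p n) Var (or_introl eq_refl)).
  - exact (step_root R tStart tAccept Var (or_intror (or_introl eq_refl))).
  - apply steps_nsteps in H2 as [[|k] Hk].
    + simpl in Hk. now subst d.
    + destruct Hk as [w [Hw _]]. exfalso. eapply passive_normal; [|exact Hw]. reflexivity.
Qed.

End Fork.

(* RMu minimizes over the first argument and stops at the value 0. *)
Definition negated_test (p : recfun) : recfun :=
  RComp (RPrec (RComp RSucc [RZero]) RZero) [RComp p [RProj 1; RProj 0]].

(** The recursion sends 0 to 1 and every successor to 0; the two projections restore the argument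
    order of [p], since the search variable comes first under [RMu]. *)
Lemma eval_negated_test p n m b :
  eval p [n; m] b -> eval (negated_test p) [m; n] (1 - b).
Proof.
  intro H. eapply eval_comp1.
  - eapply eval_comp2; [apply eval_proj; reflexivity|apply eval_proj; reflexivity|exact H].
  - clear H. induction b as [|b IH].
    + apply ev_prec0. eapply eval_comp1; [apply ev_zero|apply eval_succ].
    + eapply ev_precS; [exact IH|]. apply ev_zero.
Qed.

(** [q] is unbounded search for a witness. With a witness the evaluation is simulated up to
    acceptance; without one the negated test has the value 1 everywhere and the search runs
    forever. *)
Lemma Sigma01_search (A : nat -> Prop) : Sigma01 A ->
  exists q, forall n, A n <-> steps (fork_trs q n) (init q n) tAccept.
Proof.
  intros [Q [[p Hp] HA]]. exists (RMu (negated_test p)). intro n.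
  assert (Yes : forall m, Q n m -> eval (negated_test p) [m; n] 0).
  { intros m H. apply (eval_negated_test p n m 1), Hp, H. }
  assert (No : forall m, ~ Q n m -> eval (negated_test p) [m; n] 1).
  { intros m H. apply (eval_negated_test p n m 0), Hp, H. }
  rewrite HA. split.
  - intros [m0 Hm0].
    (* [ev_mu] demands nonzero values at all earlier candidates, hence the least witness. *)
    assert (Least : exists m, Q n m /\ forall z, z < m -> ~ Q n z).
    { revert m0 Hm0. induction m0 as [m0 IH] using lt_wf_ind. intro Hm0.
      destruct (classic (exists z, z < m0 /\ Q n z)) as [[z [Hz Hq]]|N]; [eauto|].
      exists m0. split; [exact Hm0|]. intros z Hz Hq. apply N. eauto. }
    destruct Least as [m [Hm Hlt]].
    assert (E : eval (RMu (negated_test p)) [n] m).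
    { apply ev_mu; [now apply Yes|]. intros z Hz. exists 1.
      split; [discriminate|]. apply No, Hlt, Hz. }
    eapply steps_trans; [exact (eval_steps _ (machine_fork _ _) _ _ _ E kTop)|].
    apply steps_step.
    exact (machine_step _ (machine_fork _ _) 18 [num m] _ _ eq_refl).
  - intro H. apply NNPP. intro N.
    refine (mu_diverges _ n (negated_test p) eq_refl _ H).
    intro m. exists 0. apply No. intro Hq. apply N. eauto.
Qed.

(** The program and the machine are fixed; the input enters only through its numeral. *)
Lemma Comp_fork (q : recfun) : Comp (fork_trs q).
Proof.
  assert (N : Comp num).
  { apply Comp_ext with (f := fun n => natrec tZero (fun _ t => tSucc t) n).
    - intro n. induction n as [|n IH]; [reflexivity|]. now rewrite natrec_S, IH.
    - unfold tSucc. comp. }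
  unfold fork_trs, init, tEv, args. cbn [map tlist fold_right]. unfold tCons.
  unfold trs, rule. comp.
Qed.

(** All three sets share one reduction; [g] only packs the system into a code, alone or together
    with the ground term [tStart]. *)
Lemma Sigma01_complete_of_fork (B : nat -> Prop) (g : trs -> nat) :
  Sigma01 B -> Comp g ->
  (forall q n, B (g (fork_trs q n)) <-> steps (fork_trs q n) (init q n) tAccept) ->
  Sigma01_complete B.
Proof.
  intros SB G HB. split; [exact SB|]. intros A HA.
  destruct (Sigma01_search A HA) as [q Hq]. exists (fun n => g (fork_trs q n)). split.
  - apply computable_of_Comp. pose proof (Comp_fork q). comp.
  - intro n. now rewrite HB, Hq.
Qed.

Lemma weakly_confluent_start q n :
  weakly_confluent_on (fork_trs q n) tStart <->
  steps (fork_trs q n) (init q n) tAccept.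
Proof.
  split; [apply fork_accepts|]. intro H. now apply fork_weakly_confluent.
Qed.

Lemma weakly_confluent_fork q n :
  weakly_confluent (fork_trs q n) <-> steps (fork_trs q n) (init q n) tAccept.
Proof.
  split; [intro W; apply fork_accepts, W|apply fork_weakly_confluent].
Qed.

Theorem theorem5 :
  Sigma01_complete WCR_set /\
  Sigma01_complete WCR_term_set /\
  Sigma01_complete WCR_ground_set.
Proof.
  split; [|split].
  - apply (Sigma01_complete_of_fork _ (fun R => enc R) Sigma01_WCR); [apply Comp_enc|].
    intros q n. unfold WCR_set. rewrite decode_trs_enc, weakly_confluent_fork.
    pose proof (wf_fork q n). tauto.
  - apply (Sigma01_complete_of_fork _ (fun R => enc (R, tStart)) Sigma01_WCR_term); [comp|].
    intros q n. unfold WCR_term_set.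
    change (enc (fork_trs q n, tStart)) with (cpair (enc (fork_trs q n)) (enc tStart)).
    rewrite unpair_cpair, decode_trs_enc, decode_term_enc, weakly_confluent_start.
    pose proof (wf_fork q n). tauto.
  - apply (Sigma01_complete_of_fork _ (fun R => enc (R, tStart)) Sigma01_WCR_ground); [comp|].
    intros q n. unfold WCR_ground_set.
    change (enc (fork_trs q n, tStart)) with (cpair (enc (fork_trs q n)) (enc tStart)).
    rewrite unpair_cpair, decode_trs_enc, decode_term_enc, weakly_confluent_start.
    pose proof (wf_fork q n). unfold ground. cbn. tauto.
Qed.
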